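(* Let $q\geq 3$. Let $E^{q-1}=\{(x_1,\ldots,x_q)\in\mathbb{R}^q\mid x_1+\cdots+x_q=0\}$, let $A_{q-1}$ be the root lattice in $E^{q-1}$, let $A_{q-1}^*$ be its dual lattice, and let $\mathcal{V}=\mathcal{V}(A_{q-1}^* )$ be the Voronoi tiling of $E^{q-1}$ for $A_{q-1}^*$. Then the quotient tessellation $\mathcal{V}/A_{q-1}$ of $\mathcal{V}$ by (the translations by vectors of) $A_{q-1}$ is a face-to-face tessellation of the $(q-1)$-torus $E^{q-1}/A_{q-1}$ by $(q-1)$-dimensional permutahedra, with $q$ such tiles, and the face poset of $\mathcal{V}/A_{q-1}$ is isomorphic to the $C_q$-graphicahedron $\mathcal{P}_{C_q}$.
   Context: Lattices and tiling: let $b_1,\ldots,b_q$ be the canonical basis of Euclidean $q$-space. The root lattice $A_{q-1}$ is the lattice in $E^{q-1}$ spanned by the vectors $\pm(b_j-b_k)$, $1\le j<k\le q$; a basis is $a_i=b_{i+1}-b_i$ ($i=1,\ldots,q-1$). It is the lattice of translation vectors of the infinite Euclidean Coxeter group $\tilde{A}_{q-1}$ acting on $E^{q-1}$, generated by the reflections $r_1,\ldots,r_q$, where the mirror of $r_i$ is the intersection of $E^{q-1}$ with the hyperplane $x_i=x_{i+1}$ if $i<q$, or $x_1=x_q-1$ if $i=q$. The dual lattice $A_{q-1}^*$ consists of all $v\in E^{q-1}$ with $\langle u,v\rangle\in\mathbb{Z}$ for all $u\in A_{q-1}$. The Voronoi cell of a lattice point $u$ is the set of all points of the ambient space whose distance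 from $u$ is at most their distance from every other lattice point; the Voronoi cells of $A_{q-1}^*$ are the tiles of the Voronoi tiling $\mathcal{V}$ of $E^{q-1}$. The tiling $\mathcal{V}$ is invariant under translations by $A_{q-1}$. The $(q-1)$-dimensional permutahedron is the convex polytope obtained as the convex hull of the $q!$ points of $\mathbb{R}^q$ obtained by permuting the coordinates of $(1,2,\ldots,q)$. The faces of $\mathcal{V}/A_{q-1}$ are the equivalence classes (under translation by $A_{q-1}$) of the faces of $\mathcal{V}$, of dimensions (ranks) $0,\ldots,q-1$, with two classes incident if they have incident representatives; face-to-face means that tiles meet along common faces (the intersection of two tiles on the torus is a, possibly empty, union of common faces). The face poset of $\mathcal{V}/A_{q-1}$ is the set of these faces together with a smallest face of rank $-1$ and a largest face of rank $q$. Graphicahedron: let $G$ be a finite connected simple graph with vertex set $\{1,\ldots,p\}$ and edge set $E(G)$ of size $q$. For an edge $e=\{i,j\}$ let $\tau_e=(i\;j)\in S_p$, and for $K\subseteq E(G)$ let $T_K=\langle\tau_e\mid e\in K\rangle\le S_p$. The faces of rank $i$ ($0\le i\le q$) of the graphicahedron $\mathcal{P}_G$ are the equivalence classes of pairs $(K,\alpha)$ with $K\subseteq E(G)$, $|K|=i$, $\alpha\in S_p$, where $(K,\alpha)\sim(L,\beta)$ iff $K=L$ and $T_K\alpha=T_L\beta$ (right cosets). The order is $(K,\alpha)\le(L,\beta)$ iff $K\subseteq L$ and $T_K\alpha\subseteq T_L\beta$. A smallest face of rank $-1$ is appended. Here $G=C_q$ is the $q$-cycle, with vertices $1,\ldots,q$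 and edges $\{i,i+1\}$ (indices mod $q$), so $p=q$. *)

(* Defs.v *)
From mathcomp Require Import all_boot all_order all_algebra all_fingroup.
From mathcomp Require Import all_classical all_reals all_analysis.

Set Implicit Arguments.
Unset Strict Implicit.
Unset Printing Implicit Defensive.

Import Order.TTheory GRing.Theory Num.Theory.
Import numFieldNormedType.Exports.

Local Open Scope ring_scope.

(** * Graphicahedra *)

(* A simple graph on [T] is given by a symmetric irreflexive [e : rel T]; its
   edges are unordered pairs of vertices. *)
Definition edges (T : finType) (e : rel T) : {set {set T}} :=
  [set [set ij.1; ij.2] | ij : T * T & e ij.1 ij.2]%SET.

Definition edge_group (T : finType) (K : {set {set T}}) : {set {perm T}} :=
  <<[set tperm ij.1 ij.2 | ij : T * T & [set ij.1; ij.2] \in K]%SET>>%g.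

(* [T_K alpha].  MathComp composes permutations from left to right; under the
   opposite convention one gets the left cosets [alpha T_K], and inversion of
   permutations turns one resulting poset into the other. *)
Definition pair_coset (T : finType) (x : {set {set T}} * {perm T}) :
    {set {perm T}} :=
  (edge_group x.1 :* x.2)%g.

Definition pair_equiv (T : finType) : rel ({set {set T}} * {perm T}) :=
  fun x y => (x.1 == y.1) && (pair_coset x == pair_coset y).

Definition graphicahedron_faces (T : finType) (e : rel T) :
    {set {set {set {set T}} * {perm T}}} :=
  equivalence_partition (@pair_equiv T)
    [set x : {set {set T}} * {perm T} | x.1 \subset edges e]%SET.

(* [None] is the appended smallest face. *)
Definition graphicahedron (T : finType) (e : rel T) : Type :=
  option {X : {set {set {set T}} * {perm T}} | X \in graphicahedron_faces e}.

Definition graphicahedron_le (T : finType) (e : rel T)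
    (X Y : graphicahedron e) : Prop :=
  match X, Y with
  | None, _ => True
  | Some _, None => False
  | Some X', Some Y' => exists x y, [/\ x \in val X', y \in val Y',
      x.1 \subset y.1 & pair_coset x \subset pair_coset y]
  end.

Definition graphicahedron_rank (T : finType) (e : rel T)
    (X : graphicahedron e) (k : int) : Prop :=
  match X with
  | None => k = -1
  | Some X' => exists2 x, x \in val X' & k = #|x.1|%:Z
  end.

(* Irreflexive, hence a simple graph, only for [1 < q]; a genuine [q]-cycle for
   [2 < q]. *)
Definition cycle_graph (q : nat) : rel 'I_q :=
  fun i j => (j == ordS i) || (i == ordS j).

Local Open Scope classical_set_scope.

(** * Euclidean space, convex polytopes and their faces *)

Definition dot (R : realType) (n : nat) (x y : 'rV[R]_n) : R :=
  \sum_(i < n) x 0 i * y 0 i.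

(* The library's norm on ['rV[R]_n] is the sup norm. *)
Definition edist (R : realType) (n : nat) (x y : 'rV[R]_n) : R :=
  Num.sqrt (dot (x - y) (x - y)).

Definition similar (R : realType) (n : nat) (P Q : set 'rV[R]_n) : Prop :=
  exists (c : R) (f : 'rV[R]_n -> 'rV[R]_n),
    [/\ 0 < c, forall x y, edist (f x) (f y) = c * edist x y & Q = f @` P].

Definition convex_hull (R : realType) (n : nat) (I : finType)
    (v : I -> 'rV[R]_n) : set 'rV[R]_n :=
  [set x | exists w : I -> R,
    [/\ forall i, 0 <= w i, \sum_i w i = 1 & x = \sum_i w i *: v i]].

Definition permutahedron (R : realType) (q : nat) : set 'rV[R]_q :=
  convex_hull (fun s : 'S_q => \row_i (s i).+1%:R).
Arguments permutahedron R q : clear implicits.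

(* Nonempty faces, [P] itself included ([a = 0], [c = 0]). *)
Definition polytope_face (R : realType) (n : nat) (P F : set 'rV[R]_n) : Prop :=
  F !=set0 /\
  exists (a : 'rV[R]_n) (c : R),
    (forall x, P x -> dot a x <= c) /\ F = P `&` [set x | dot a x = c].

(* Dimension of the affine hull of a nonempty set [F]: the largest [k] such
   that [F] contains [k.+1] affinely independent points. *)
Definition affine_dim (R : realType) (n : nat) (F : set 'rV[R]_n) : nat :=
  \max_(k < n.+1 | `[< exists (x : 'rV[R]_n) (M : 'M[R]_(k, n)),
    [/\ F x, forall i, F (x + row i M) & row_free M] >]) k.

(** * The lattices and the Voronoi tiling *)

Definition hyperplane0 (R : realType) (q : nat) : set 'rV[R]_q :=
  [set x | \sum_(i < q) x 0 i = 0].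
Arguments hyperplane0 R q : clear implicits.

Definition root_lattice (R : realType) (q : nat) : set 'rV[R]_q :=
  [set x | exists c : 'I_q -> 'I_q -> int,
    x = \sum_(j < q) \sum_(k < q | (j < k)%N)
          (delta_mx 0 j - delta_mx 0 k) *~ c j k].
Arguments root_lattice R q : clear implicits.

Definition dual_root_lattice (R : realType) (q : nat) : set 'rV[R]_q :=
  [set v | hyperplane0 R q v /\
    forall u, root_lattice R q u -> dot u v \is a Num.int].
Arguments dual_root_lattice R q : clear implicits.

Definition voronoi_cell (R : realType) (q : nat) (u : 'rV[R]_q) :
    set 'rV[R]_q :=
  [set x | hyperplane0 R q x /\
    forall w, dual_root_lattice R q w -> edist x u <= edist x w].

Definition voronoi_tiles (R : realType) (q : nat) : set (set 'rV[R]_q) :=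
  @voronoi_cell R q @` dual_root_lattice R q.
Arguments voronoi_tiles R q : clear implicits.

Definition voronoi_faces (R : realType) (q : nat) : set (set 'rV[R]_q) :=
  [set F | exists2 P, voronoi_tiles R q P & polytope_face P F].
Arguments voronoi_faces R q : clear implicits.

(** * The quotient tessellation and its face poset *)

Definition translation_class (R : realType) (q : nat) (F : set 'rV[R]_q) :
    set (set 'rV[R]_q) :=
  [set [set x + t | x in F] | t in root_lattice R q].

Definition quotient_tiles (R : realType) (q : nat) :
    set (set (set 'rV[R]_q)) :=
  @translation_class R q @` voronoi_tiles R q.
Arguments quotient_tiles R q : clear implicits.

Definition quotient_faces (R : realType) (q : nat) :
    set (set (set 'rV[R]_q)) :=
  @translation_class R q @` voronoi_faces R q.
Arguments quotient_faces R q : clear implicits.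

Definition incident (R : realType) (q : nat) (C D : set (set 'rV[R]_q)) : Prop :=
  exists F G, [/\ C F, D G & F `<=` G].

Inductive quotient_poset (R : realType) (q : nat) : Type :=
| Least
| Face of quotient_faces R q
| Greatest.

Definition quotient_le (R : realType) (q : nat)
    (x y : quotient_poset R q) : Prop :=
  match x, y with
  | Least, _ => True
  | _, Greatest => True
  | Face C, Face D => incident (val C) (val D)
  | _, _ => False
  end.

Definition quotient_rank (R : realType) (q : nat)
    (x : quotient_poset R q) (k : int) : Prop :=
  match x with
  | Least => k = -1
  | Face C => exists2 F, val C F & k = (affine_dim F)%:Z
  | Greatest => k = q%:Z
  end.

(** * The torus [E / A] and tessellations of it *)

(* Points of the torus are the cosets [x + A] with [x] in [E]. *)
Definition torus_proj (R : realType) (q : nat) (x : 'rV[R]_q) : set 'rV[R]_q :=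
  [set x + t | t in root_lattice R q].

Definition torus (R : realType) (q : nat) : set (set 'rV[R]_q) :=
  @torus_proj R q @` hyperplane0 R q.
Arguments torus R q : clear implicits.

(* Quotient topology of the subspace topology of [E]. *)
Definition torus_open (R : realType) (q : nat) (U : set (set 'rV[R]_q)) : Prop :=
  U `<=` torus R q /\
  open (@torus_proj R q @^-1` U : set (subspace (hyperplane0 R q))).

Definition torus_interior (R : realType) (q : nat) (S : set (set 'rV[R]_q)) :
    set (set 'rV[R]_q) :=
  \bigcup_(U in [set U | torus_open U /\ U `<=` S]) U.

(* The region of the torus occupied by a class of faces. *)
Definition support (R : realType) (q : nat) (C : set (set 'rV[R]_q)) :
    set (set 'rV[R]_q) :=
  \bigcup_(F in C) (@torus_proj R q @` F).

Definition tessellates_torus (R : realType) (q : nat)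
    (tiles : set (set (set 'rV[R]_q))) : Prop :=
  \bigcup_(C in tiles) support C = torus R q /\
  forall C D, tiles C -> tiles D -> C <> D ->
    torus_interior (support C) `&` torus_interior (support D) = set0.

Definition face_to_face (R : realType) (q : nat)
    (tiles faces : set (set (set 'rV[R]_q))) : Prop :=
  forall C D, tiles C -> tiles D ->
    exists S : set (set (set 'rV[R]_q)),
      (forall X, S X -> [/\ faces X, incident X C & incident X D]) /\
      support C `&` support D = \bigcup_(X in S) support X.

(* Injectivity of the projection says that the tile, carried to the torus, is
   still a permutahedron: none of its boundary points become identified. *)
Definition permutahedral (R : realType) (q : nat) (P : set 'rV[R]_q) : Prop :=
  similar (permutahedron R q) P /\ set_inj P (@torus_proj R q).

(* Main.v *)
Require Import Defs.
From mathcomp Require Import all_boot all_order all_algebra all_fingroup.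
From mathcomp Require Import all_classical all_reals all_analysis.
From mathcomp Require Import ring lra zify.

Set Implicit Arguments.
Unset Strict Implicit.
Unset Printing Implicit Defensive.

Import Order.TTheory GRing.Theory Num.Theory.
Import numFieldNormedType.Exports.

Local Open Scope ring_scope.

(** The dual lattice consists of the points [centered z], with [z] integral and
    [centered] the orthogonal projection onto the hyperplane of total [0].  With
    [u = x - v], comparing the distances from [x] to [v] and to
    [v + centered (ind S)] gives the inequality

      sum of the [u i], [i] in [S]  <=  #|S| (q - #|S|) / 2q,

    and these inequalities, one for each set [S] of coordinates, cut out the
    whole cell ([voronoi_cell_shift]): an integral vector is a sum of indicators
    of nested sets, and indicators of nested sets have projections with
    nonnegative inner product ([excess_nat]).  The same argument shows that the
    lattice points nearest to [x] besides [v] are the [v + centered (ind S)] with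
    [S] tight, that is with equality above ([voronoi_tightP]).

    The bound is strictly concave in [#|S|], so tight sets form a chain
    ([tight_nested]).  If the chain does not separate two coordinates [i] and
    [j], the point can be moved along [e_i - e_j] in both directions until a new
    set becomes tight ([cell_push]).  If it separates all of them, the point is
    one of the [vtx s], the centered and rescaled permutations
    ([separated_vtx]).  By induction on the number of sets that are not tight,
    a cell is the convex hull of the [vtx s] ([cell_hull]): a permutahedron.

    The lattice points nearest to [vtx s] are the projections [site s r] of the
    indicators of the sets of positions with value above [r], for [r < q].  They
    represent each class of the dual lattice modulo the root lattice once
    ([site_class], [root_class]), hence the [q] tiles.  A face is determined by
    the set of lattice points nearest to its generic points
    ([polytope_face_tights]) and contains a vertex, so up to translation every
    face is [face s J], the intersection of the cells of the [site s a] with [a]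
    in a nonempty set [J] ([faceP]).  Exchanging the values [r] and [r + 1 mod q]
    in [s] leads to a neighbouring vertex and keeps all the sites but the one of
    index [r] ([vtx_neighbor]).  So the edges of [face s J] at [vtx s] correspond
    to the [r] outside [J], which gives its dimension ([affine_dim_face]), and
    its vertices correspond to the coset of [s] under the group generated by the
    transpositions [(r r+1)] with [r] outside [J].

    That group has an arithmetic description ([edge_groupP]): a permutation
    belongs to it when it moves each [x] to some [y] for which
    [(a < x) - (a < y)] does not depend on [a] in [J].  The same condition, for
    [x = s i] and [y = u i], says that the sites of [s] and [u] with indices in
    [J] differ by a single translation.  Hence, but for its least element,
    each of the two posets is the set of pairs [(J, s)], preordered by [code_le],
    up to equivalence; the empty [J] gives the greatest element.  The isomorphism
    sends the face given by [J] and [s] to the class of the pair formed by the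
    edges [{r, r+1}] with [r] outside [J] and the permutation inverse to [s]. *)

(** * The cycle graph and the groups generated by its edges *)

Section Cycle.
Variable q : nat.
Implicit Types (a b r x y z : 'I_q) (J : {set 'I_q}) (s u : 'S_q).

Lemma val_ordS x : ordS x = (if x.+1 < q then x.+1 else 0)%N :> nat.
Proof.
rewrite /=; have [h|h] := ltnP x.+1 q; first by rewrite modn_small.
have -> : x.+1 = q by have := ltn_ord x; lia.
by rewrite modnn.
Qed.

Lemma ordS_ind (P : 'I_q -> Prop) r :
  P r -> (forall x, P x -> P (ordS x)) -> forall x, P x.
Proof.
move=> Pr PS; have q0 : (0 < q)%N by have := ltn_ord r; lia.
have up x y : P x -> (x <= y)%N -> P y.
  move: {2}(y - x)%N (erefl (y - x)%N) => n; elim: n x => [|n IH] x hn Px xy.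
    by have -> : y = x by apply/val_inj => /=; lia.
  have S : ordS x = x.+1 :> nat by rewrite val_ordS; case: ltnP => // ?; have := ltn_ord y; lia.
  by apply: (IH (ordS x)); rewrite ?S; [lia|exact: PS|lia].
have ql : (q.-1 < q)%N by lia.
have Pl : P (Ordinal ql) by apply: up Pr _ => /=; have := ltn_ord r; lia.
move=> x; apply: (up (ordS (Ordinal ql))); first exact: PS.
by rewrite val_ordS /= prednK // ltnn.
Qed.

(** [x] and [y] are joined by an arc of the cycle that avoids the edges
    [{a, a + 1}] with [a] in [J]: no such edge lies between them, or all of them
    do.  Both cases say that [(a < x) - (a < y)] is constant on [J]. *)
Definition linked J x y : Prop :=
  {in J &, forall a b, ((a < x) + (b < y) = (b < x) + (a < y))%N}.

Lemma linked_refl J x : linked J x x.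
Proof. by move=> a b _ _; rewrite addnC. Qed.

Lemma linked_sym J x y : linked J x y -> linked J y x.
Proof. by move=> h a b ha hb; have := h a b ha hb; lia. Qed.

Lemma linked_trans J x y z : linked J x y -> linked J y z -> linked J x z.
Proof.
by move=> h k a b ha hb; have := h a b ha hb; have := k a b ha hb; lia.
Qed.

Lemma linked_ordS J r : r \notin J -> linked J r (ordS r).
Proof.
move=> hr a b ha hb.
have na : a <> r :> nat by move=> e; move: hr; rewrite -(val_inj e) ha.
have nb : b <> r :> nat by move=> e; move: hr; rewrite -(val_inj e) hb.
rewrite val_ordS; have := ltn_ord a; have := ltn_ord b; have [?|?] := ltnP r.+1 q; lia.
Qed.

Section GeneratedByEdges.
Variables (G : {group 'S_q}) (J : {set 'I_q}).
Hypothesis edgeG : forall r, r \notin J -> tperm r (ordS r) \in G.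

Lemma tperm_trans x y z : tperm x z \in G -> tperm z y \in G -> tperm x y \in G.
Proof.
move=> hxz hzy; have [->|nxy] := eqVneq x y; first by rewrite tperm1 group1.
have [e|nxz] := eqVneq x z; first by rewrite e.
rewrite -(_ : (tperm x z ^ tperm z y)%g = tperm x y) ?groupJ//.
by rewrite tpermJ tpermL tpermD // eq_sym.
Qed.

Lemma tperm_path x y : (x <= y)%N ->
  (forall r, (x <= r < y)%N -> r \notin J) -> tperm x y \in G.
Proof.
move: {2}(y - x)%N (erefl (y - x)%N) => n; elim: n x => [|n IH] x hn hxy hJ.
  have -> : x = y by apply/val_inj => /=; lia.
  by rewrite tperm1 group1.
have xy : (x < y)%N by lia.
have S : ordS x = x.+1 :> nat by rewrite val_ordS; case: ltnP => ?; have := ltn_ord y; lia.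
apply: (@tperm_trans _ _ (ordS x)); first by apply: edgeG; apply: hJ; lia.
by apply: IH; rewrite S; [lia|lia|move=> r hr; apply: hJ; lia].
Qed.

(** Two linked vertices are the ends of a path of available edges, one way or the
    other around the cycle, and the transpositions along a path generate the
    transposition of its ends. *)
Lemma tperm_linked x y : linked J x y -> tperm x y \in G.
Proof.
wlog xy : x y / (x <= y)%N => [wlg|] hl.
  have [/wlg|/ltnW/wlg] := leqP x y; first exact.
  by rewrite tpermC; apply; apply: linked_sym.
have [/existsP[r /andP[rJ hr]]|] := boolP [exists r in J, (x <= r < y)%N]; last first.
  move=> /existsPn h; apply: tperm_path => // r hr.
  by apply/negP => rJ; have := h r; rewrite rJ hr.
(* All of [J] then lies between [x] and [y], so the other arc avoids [J]. *)
have out a : a \in J -> (x <= a < y)%N by move=> /hl/(_ rJ); lia.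
have q0 : (0 < q)%N by have := ltn_ord x; lia.
have ql : (q.-1 < q)%N by lia.
pose o := Ordinal q0; pose l := Ordinal ql.
have Sl : ordS l = o by apply/val_inj; rewrite /= prednK// modnn.
have xo : tperm x o \in G.
  rewrite tpermC; apply: tperm_path => //= a ha; apply/negP => /out; lia.
have ly : tperm l y \in G.
  rewrite tpermC; apply: tperm_path => [|a ha] /=; first by have := ltn_ord y; lia.
  by apply/negP => /out; move: ha => /=; lia.
have lo : tperm l o \in G.
  rewrite -Sl; apply: edgeG; apply/negP => /out /=; have := ltn_ord y; lia.
by apply: (@tperm_trans _ _ o) => //; apply: (@tperm_trans _ _ l) => //; rewrite tpermC.
Qed.

(** Composing with the transposition of [x] and [s x] makes [x] a fixed point and
    keeps all the others. *)
Lemma perm_linked s : (forall x, linked J x (s x)) -> s \in G.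
Proof.
move: {2}#|[set x | s x != x]| (leqnn #|[set x | s x != x]|) => n.
elim: n s => [|n IH] s hn hs.
  suff -> : s = 1%g by apply: group1.
  apply/permP => x; rewrite perm1; apply/eqP; apply/negPn/negP => hx.
  by move: hn; rewrite leqn0 cards_eq0 => /eqP/setP/(_ x); rewrite !inE hx.
have [x hx|h] := pickP [pred x | s x != x]; last first.
  by apply: IH => //; rewrite (eq_card0 (A := [set x | s x != x])) // => x; rewrite inE; have /= := h x.
have -> : s = ((s * tperm x (s x)) * tperm x (s x))%g by rewrite -mulgA tperm2 mulg1.
apply: groupM; last exact: tperm_linked.
apply: IH => [|y]; last first.
  rewrite permM; have [e|n1] := eqVneq (s y) x.
    by rewrite e tpermL -[X in linked _ _ (s X)]e; apply: (linked_trans (hs y)).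
  have [/perm_inj ->|n2] := eqVneq (s y) (s x); last by rewrite tpermD // eq_sym.
  by rewrite tpermR; apply: linked_refl.
rewrite -ltnS; apply: leq_trans hn; apply: proper_card; apply/fintype.properP; split.
  apply/fintype.subsetP => y; rewrite !inE permM; apply: contra => /eqP sy.
  rewrite sy tpermD //; apply: contra hx => /eqP xy; first by rewrite xy sy.
  by apply/eqP/(@perm_inj _ s); rewrite xy sy.
by exists x; rewrite !inE // permM tpermR eqxx.
Qed.

End GeneratedByEdges.

Definition cyc_edge r : {set 'I_q} := [set r; ordS r]%SET.

(** The lattice points of a face are indexed by [J], its edge directions by the
    complement. *)
Definition edges_off J : {set {set 'I_q}} := [set cyc_edge r | r in ~: J]%SET.

Lemma ordS_neq x : (1 < q)%N -> ordS x != x.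
Proof.
by move=> q1; apply/eqP => /(congr1 (@nat_of_ord q)); rewrite val_ordS; case: ltnP => ?; lia.
Qed.

Lemma tperm_cyc_edge (q1 : (1 < q)%N) x y r :
  [set x; y]%SET = cyc_edge r -> tperm x y = tperm r (ordS r).
Proof.
move=> e; have hx : x \in cyc_edge r by rewrite -e set21.
have hy : y \in cyc_edge r by rewrite -e set22.
have xy : x != y.
  apply: contraNneq (ordS_neq r q1) => xy.
  have : r \in [set x; y]%SET by rewrite e set21.
  have : ordS r \in [set x; y]%SET by rewrite e set22.
  by rewrite xy !inE !orbb => /eqP -> /eqP ->.
move: hx hy xy; rewrite !inE => /orP[]/eqP hx /orP[]/eqP hy; rewrite {}hx {}hy ?eqxx //.
by rewrite tpermC.
Qed.

(** Being linked is an equivalence relation, so the permutations that move points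
    within its classes form a group; it contains the generators. *)
Lemma edge_groupP (q1 : (1 < q)%N) J s :
  s \in edge_group (edges_off J) <-> (forall x, linked J x (s x)).
Proof.
split=> [|hs]; last first.
  apply: (@perm_linked [group of edge_group (edges_off J)] J) => // r hr.
  apply: mem_gen; apply/imsetP; exists (r, ordS r) => //.
  by rewrite inE; apply/imsetP; exists r; rewrite ?inE.
pose L := [set s : 'S_q | `[< forall x, linked J x (s x) >]]%SET.
have gL : group_set L.
  apply/group_setP; split=> [|s1 s2]; rewrite !inE.
    by apply/asboolP => x; rewrite perm1; apply: linked_refl.
  move=> /asboolP h1 /asboolP h2; apply/asboolP => x; rewrite permM.
  exact: linked_trans (h1 x) (h2 _).
suff : edge_group (edges_off J) \subset Group gL.
  by move=> /fintype.subsetP h /h; rewrite inE => /asboolP.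
rewrite gen_subG; apply/fintype.subsetP => t /imsetP[[x y]]; rewrite inE /=.
move=> /imsetP[r]; rewrite inE => hr /(tperm_cyc_edge q1) e ->.
rewrite inE e; apply/asboolP => z; case: tpermP => [->|->|_ _].
- exact: linked_ordS.
- by apply/linked_sym/linked_ordS.
- exact: linked_refl.
Qed.

Hypothesis q3 : (3 <= q)%N.

(** False for [q = 2], where both edges join [0] and [1]. *)
Lemma cyc_edge_inj : injective cyc_edge.
Proof.
move=> x y e; have : x \in cyc_edge y by rewrite -e set21.
have : ordS x \in cyc_edge y by rewrite -e set22.
rewrite !inE => /orP[/eqP e1|/eqP/ordS_inj//] /orP[/eqP //|/eqP e2].
move: e1 e2 => /(congr1 (@nat_of_ord q)) + /(congr1 (@nat_of_ord q)).
rewrite !val_ordS; case: ltnP => ?; case: ltnP => ?; lia.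
Qed.

Lemma edges_cycle : edges (@cycle_graph q) = edges_off finset.set0.
Proof.
apply/setP => K; apply/imsetP/imsetP => [[[x y]]|[r _ ->]]; last first.
  by exists (r, ordS r) => //; rewrite !inE /cycle_graph eqxx.
rewrite !inE => /orP[] /= /eqP -> ->; first by exists x => //; rewrite !inE.
by exists y; rewrite ?inE // /cyc_edge finset.setUC.
Qed.

Lemma sub_edges_off J J' : (edges_off J \subset edges_off J') = (J' \subset J).
Proof.
apply/fintype.subsetP/fintype.subsetP => h r => [|].
  move=> rJ'; apply/negPn/negP => rJ.
  have /h/imsetP[r' r'J' /cyc_edge_inj e] : cyc_edge r \in edges_off J.
    by apply/imsetP; exists r; rewrite ?inE.
  by move: r'J'; rewrite -e inE rJ'.
move=> /imsetP[r' r'J ->]; apply/imsetP; exists r' => //.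
by move: r'J; rewrite !inE; apply: contra; apply: h.
Qed.

Lemma card_edges_off J : (#|edges_off J| = q - #|J|)%N.
Proof.
rewrite card_imset; last exact: cyc_edge_inj.
by rewrite -[X in (X - _)%N](card_ord q) -(cardsC J) addKn.
Qed.

Lemma edges_offP (K : {set {set 'I_q}}) :
  K \subset edges (@cycle_graph q) -> exists J, K = edges_off J.
Proof.
move=> /fintype.subsetP hK; exists [set r | cyc_edge r \notin K]%SET.
apply/setP => A; apply/idP/imsetP => [AK|[r]]; last by rewrite !inE negbK => h ->.
have := hK _ AK; rewrite edges_cycle => /imsetP[r _ e].
by exists r; rewrite // !inE negbK -e.
Qed.

End Cycle.

Local Open Scope classical_set_scope.

(** * The lattices and the distance comparison *)

Section Dot.
Variables (R : realType) (n : nat).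
Implicit Types (x y z : 'rV[R]_n).

Definition sq x : R := dot x x.

Lemma dotC x y : dot x y = dot y x.
Proof. by apply: eq_bigr => i _; rewrite mulrC. Qed.

Lemma dotDl x y z : dot (x + y) z = dot x z + dot y z.
Proof. by rewrite -big_split; apply: eq_bigr => i _; rewrite mxE mulrDl. Qed.

Lemma dotNl x z : dot (- x) z = - dot x z.
Proof. by rewrite -sumrN; apply: eq_bigr => i _; rewrite mxE mulNr. Qed.

Lemma dotZl c x z : dot (c *: x) z = c * dot x z.
Proof. by rewrite mulr_sumr; apply: eq_bigr => i _; rewrite mxE mulrA. Qed.

Lemma dotDr x y z : dot z (x + y) = dot z x + dot z y.
Proof. by rewrite !(dotC z) dotDl. Qed.

Lemma dotNr x z : dot z (- x) = - dot z x.
Proof. by rewrite !(dotC z) dotNl. Qed.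

Lemma dotZr c x z : dot z (c *: x) = c * dot z x.
Proof. by rewrite !(dotC z) dotZl. Qed.

Lemma dot0l x : dot 0 x = 0.
Proof. by apply: big1 => i _; rewrite mxE mul0r. Qed.

Lemma dot_suml (I : finType) (F : I -> 'rV[R]_n) x :
  dot (\sum_i F i) x = \sum_i dot (F i) x.
Proof.
rewrite /dot exchange_big /=; apply: eq_bigr => j _.
by rewrite summxE mulr_suml.
Qed.

Definition dotE := (dotDl, dotDr, dotNl, dotNr, dotZl, dotZr).

Lemma rowBE x y i : (x - y) 0 i = x 0 i - y 0 i.
Proof. by rewrite !mxE. Qed.

Lemma sqB x y : sq (x - y) = sq x - 2 * dot x y + sq y.
Proof. by rewrite /sq !dotE (dotC y x); ring. Qed.

Lemma sq_ge0 x : 0 <= sq x.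
Proof. by apply: sumr_ge0 => i _; rewrite -expr2 sqr_ge0. Qed.

Lemma sq_eq0 x : sq x = 0 -> x = 0.
Proof.
move=> /eqP; rewrite psumr_eq0 => [/allP h|i _]; last by rewrite -expr2 sqr_ge0.
apply/rowP => i; have := h i (mem_index_enum _).
by rewrite -expr2 sqrf_eq0 mxE => /eqP.
Qed.

Lemma dot_delta i x : dot (delta_mx 0 i) x = x 0 i.
Proof.
rewrite /dot (bigD1 i)//= big1 ?addr0 => [|j ji]; rewrite mxE !eqxx /=.
  by rewrite mul1r.
by rewrite (negbTE ji) mul0r.
Qed.

End Dot.

Section Lattice.
Variables (R : realType) (q : nat).
Hypothesis q0 : (0 < q)%N.
Implicit Types (u v w x y z t : 'rV[R]_q) (S T : {set 'I_q}).

Local Notation E := (hyperplane0 R q).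
Local Notation A := (root_lattice R q).
Local Notation A' := (dual_root_lattice R q).

Lemma qR0 : q%:R != 0 :> R. Proof. by rewrite pnatr_eq0 -lt0n. Qed.

Lemma qR_gt0 : 0 < q%:R :> R. Proof. by rewrite ltr0n. Qed.

Definition tot x : R := \sum_i x 0 i.

Lemma totD x y : tot (x + y) = tot x + tot y.
Proof. by rewrite -big_split; apply: eq_bigr => i _; rewrite mxE. Qed.

Lemma totN x : tot (- x) = - tot x.
Proof. by rewrite -sumrN; apply: eq_bigr => i _; rewrite mxE. Qed.

Lemma totZ c x : tot (c *: x) = c * tot x.
Proof. by rewrite mulr_sumr; apply: eq_bigr => i _; rewrite mxE. Qed.

Lemma tot0 : tot 0 = 0.
Proof. by apply: big1 => i _; rewrite mxE. Qed.

Lemma tot_const c : tot (const_mx c) = c * q%:R.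
Proof.
by rewrite /tot (eq_bigr (fun=> c)) => [|i _]; rewrite ?mxE // sumr_const card_ord mulr_natr.
Qed.

Lemma hyperplaneD x y : E x -> E y -> E (x + y).
Proof. by move=> hx hy; rewrite /hyperplane0 /= -/(tot _) totD /tot hx hy addr0. Qed.

Lemma hyperplaneN x : E x -> E (- x).
Proof. by move=> hx; rewrite /hyperplane0 /= -/(tot _) totN /tot hx oppr0. Qed.

Lemma hyperplaneZ c x : E x -> E (c *: x).
Proof. by move=> hx; rewrite /hyperplane0 /= -/(tot _) totZ /tot hx mulr0. Qed.

Lemma hyperplane_0 : E 0.
Proof. by rewrite /hyperplane0 /= -/(tot _) tot0. Qed.

Lemma tot_delta i : tot (delta_mx 0 i) = 1.
Proof.
rewrite /tot (bigD1 i)//= big1 ?addr0 => [|j ji]; rewrite mxE !eqxx //=.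
by rewrite (negbTE ji).
Qed.

Definition int_row x := forall i, x 0 i \is a Num.int.

Lemma int_rowD x y : int_row x -> int_row y -> int_row (x + y).
Proof. by move=> hx hy i; rewrite mxE rpredD. Qed.

Lemma int_rowN x : int_row x -> int_row (- x).
Proof. by move=> hx i; rewrite mxE rpredN. Qed.

Lemma int_row_sum (I : finType) (P : pred I) (F : I -> 'rV[R]_q) :
  (forall i, P i -> int_row (F i)) -> int_row (\sum_(i | P i) F i).
Proof. by move=> h j; rewrite summxE; apply: rpred_sum => i /h. Qed.

Lemma int_row_tot x : int_row x -> tot x \is a Num.int.
Proof. by move=> h; apply: rpred_sum. Qed.

Lemma tot_sum (I : finType) (P : pred I) (F : I -> 'rV[R]_q) :
  tot (\sum_(i | P i) F i) = \sum_(i | P i) tot (F i).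
Proof. exact: (big_morph tot totD tot0). Qed.

Lemma int_row_delta i : int_row (delta_mx 0 i).
Proof. by move=> j; rewrite mxE; exact: natr_int. Qed.

Lemma root_latticeP x : A x <-> E x /\ int_row x.
Proof.
split=> [[c ->]|[xE xZ]]; first split.
- change (tot (\sum_(j < q) \sum_(k < q | (j < k)%N)
          (delta_mx 0 j - delta_mx 0 k) *~ c j k) = 0).
  rewrite tot_sum big1 // => j _; rewrite tot_sum big1 // => k _.
  by rewrite -scaler_int totZ totD totN !tot_delta subrr mulr0.
- apply: int_row_sum => j _; apply: int_row_sum => k _ i.
  rewrite -scaler_int mxE rpredM ?intr_int //.
  by apply: int_rowD; [|apply: int_rowN]; apply: int_row_delta.
(* The total is [0], so [x] is the sum of the [x k] times [b k - b o]. *)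
pose o : 'I_q := Ordinal q0.
pose b i : 'rV[R]_q := delta_mx 0 i.
exists (fun j k => if j == o then - Num.floor (x 0 k) else 0).
rewrite (bigD1 o) //= [X in _ + X]big1 ?addr0 => [|j /negbTE jo]; last first.
  by rewrite big1 // => k _; rewrite jo mulr0z.
rewrite (eq_bigr (fun k => x 0 k *: b k - x 0 k *: b o)) => [|k k0]; last first.
  rewrite mulrNz -mulNrz opprB -scaler_int scalerBr.
  by have := xZ k; rewrite intrEfloor => /eqP ->.
rewrite sumrB -scaler_suml {1}[x]row_sum_delta (bigD1 o) //=.
have e i : (i != o) = (0 < i)%N by rewrite -val_eqE /= lt0n.
under eq_bigl do rewrite e; rewrite addrC; congr (_ + _).
rewrite -scaleNr; congr (_ *: _); apply/eqP; rewrite -addr_eq0; apply/eqP.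
by move: xE; rewrite /hyperplane0 /= (bigD1 o) //=; under eq_bigl do rewrite e.
Qed.

Lemma root_hyperplane t : A t -> E t. Proof. by case/root_latticeP. Qed.

Lemma root_lattice0 : A 0.
Proof.
apply/root_latticeP; split; first exact: hyperplane_0.
by move=> i; rewrite mxE; exact: int_num0.
Qed.

Lemma root_latticeD t u : A t -> A u -> A (t + u).
Proof.
move=> /root_latticeP[h1 h2] /root_latticeP[h3 h4]; apply/root_latticeP.
by split; [exact: hyperplaneD|exact: int_rowD].
Qed.

Lemma root_latticeN t : A t -> A (- t).
Proof.
move=> /root_latticeP[h1 h2]; apply/root_latticeP.
by split; [exact: hyperplaneN|exact: int_rowN].
Qed.

Lemma root_latticeB t u : A t -> A u -> A (t - u).
Proof. by move=> ht hu; apply: root_latticeD => //; apply: root_latticeN. Qed.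

Lemma dualD v w : A' v -> A' w -> A' (v + w).
Proof.
move=> [h1 h2] [h3 h4]; split; first exact: hyperplaneD.
by move=> u uA; rewrite dotDr rpredD ?h2 ?h4.
Qed.

Lemma dualN v : A' v -> A' (- v).
Proof.
move=> [h1 h2]; split; first exact: hyperplaneN.
by move=> u uA; rewrite dotNr rpredN h2.
Qed.

Lemma dualB v w : A' v -> A' w -> A' (v - w).
Proof. by move=> hv hw; apply: dualD => //; apply: dualN. Qed.

Lemma root_dual t : A t -> A' t.
Proof.
move=> /root_latticeP[h1 h2]; split=> // u /root_latticeP[_ uZ].
by apply: rpred_sum => i _; apply: rpredM.
Qed.

Lemma dual0 : A' 0. Proof. exact: root_dual root_lattice0. Qed.

Lemma dual_hyperplane v : A' v -> E v. Proof. by case. Qed.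

(** The orthogonal projection onto the hyperplane of total [0]. *)
Definition centered z : 'rV[R]_q := z - const_mx (tot z / q%:R).

Lemma centeredE z i : centered z 0 i = z 0 i - tot z / q%:R.
Proof. by rewrite !mxE. Qed.

Lemma centeredD z w : centered (z + w) = centered z + centered w.
Proof. by apply/rowP => i; rewrite !mxE totD; ring. Qed.

Lemma centeredN z : centered (- z) = - centered z.
Proof. by apply/rowP => i; rewrite !mxE totN; ring. Qed.

Lemma centered_const c : centered (const_mx c) = 0.
Proof. by apply/rowP => i; rewrite !mxE tot_const mulfK ?qR0 // subrr. Qed.

Lemma centered_hyperplane z : E (centered z).
Proof.
rewrite /hyperplane0 /= -/(tot _) totD totN tot_const divfK ?subrr //; exact: qR0.
Qed.

Lemma centeredK z : E z -> centered z = z.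
Proof. by move=> h; apply/rowP => i; rewrite centeredE /tot h mul0r subr0. Qed.

Lemma dot_const c y : dot (const_mx c) y = c * tot y.
Proof. by rewrite mulr_sumr; apply: eq_bigr => i _; rewrite mxE. Qed.

Lemma dot_centeredl z y : E y -> dot (centered z) y = dot z y.
Proof. by move=> h; rewrite dotDl dotNl dot_const /tot h mulr0 subr0. Qed.

Lemma sq_centered z : sq (centered z) = sq z - tot z ^+ 2 / q%:R.
Proof.
rewrite /sq dot_centeredl; last exact: centered_hyperplane.
by rewrite dotC dotDl dotNl dot_const; ring.
Qed.

Lemma dual_root_latticeP v : A' v <-> exists2 z, int_row z & v = centered z.
Proof.
split=> [[vE vA]|[z zZ ->]]; last first.
  split; first exact: centered_hyperplane.
  move=> u /root_latticeP[uE uZ]; rewrite dotC dot_centeredl //.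
  by apply: rpred_sum => i _; apply: rpredM.
pose o : 'I_q := Ordinal q0.
exists (v - const_mx (v 0 o)); last by rewrite centeredD centeredN centered_const subr0 centeredK.
move=> i; have := vA (delta_mx 0 i - delta_mx 0 o).
rewrite !mxE dotDl dotNl !dot_delta; apply; apply/root_latticeP; split.
  by rewrite /hyperplane0 /= -/(tot _) totD totN !tot_delta subrr.
by apply: int_rowD; [|apply: int_rowN]; apply: int_row_delta.
Qed.

(** * Voronoi cells *)

Lemma voronoi_cellP v x :
  voronoi_cell v x <-> E x /\ forall w, A' w -> sq (x - v) <= sq (x - w).
Proof.
by split=> -[h1 h2]; split=> // w /h2; rewrite /edist ler_sqrt // sq_ge0.
Qed.

Lemma voronoi_cell_translate t v x :
  A' t -> voronoi_cell (v + t) x <-> voronoi_cell v (x - t).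
Proof.
move=> tA; split=> /voronoi_cellP[h1 h2]; apply/voronoi_cellP; split.
- by apply: hyperplaneD => //; apply: hyperplaneN; case: tA.
- by move=> w wA; have := h2 (w + t) (dualD wA tA); rewrite !opprD !addrA ![x - _ - t]addrAC.
- by rewrite -(subrK t x); apply: hyperplaneD => //; case: tA.
- move=> w wA; have := h2 (w - t) (dualB wA tA).
  by rewrite opprB !addrA subrK opprD !addrA addrAC.
Qed.

(** A cell therefore determines the lattice point that it belongs to. *)
Lemma voronoi_center v w : voronoi_cell w v -> A' v -> v = w.
Proof.
move=> /voronoi_cellP[_ h] /h; rewrite subrr {2}/sq dot0l => h0.
by apply/subr0_eq/sq_eq0/le_anti; rewrite h0 sq_ge0.
Qed.

Lemma voronoi_sq_eq x v w : voronoi_cell v x -> voronoi_cell w x ->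
  A' v -> A' w -> sq (x - v) = sq (x - w).
Proof.
move=> /voronoi_cellP[_ hv] /voronoi_cellP[_ hw] vA wA.
by apply/le_anti; rewrite hv // hw.
Qed.

Lemma voronoi_cell_sq x v w : voronoi_cell v x -> sq (x - w) <= sq (x - v) ->
  voronoi_cell w x.
Proof.
move=> /voronoi_cellP[xE hv] h; apply/voronoi_cellP; split=> // w' /hv.
exact: le_trans.
Qed.

(** Rounding to [0] or [1] is optimal for a number between [-1/2] and [3/2]. *)
Lemma sq_round (a m : R) : - (1 / 2) <= a -> a <= 3 / 2 -> m \is a Num.int ->
  (a - (1 / 2 < a)%R%:R) ^+ 2 <= (a - m) ^+ 2.
Proof.
move=> h1 h2 hm; set b := (_ < _)%R.
have h3 : a - b%:R <= 1 / 2 by rewrite /b; case: ltP => /= h; lra.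
have h4 : - (1 / 2) <= a - b%:R by rewrite /b; case: ltP => /= h; lra.
have hi : m - b%:R \is a Num.int by rewrite rpredB // natr_int.
have k1 := intr_ler_sqr hi.
have k2 : - (m - b%:R) <= (m - b%:R) ^+ 2.
  by rewrite -sqrrN; apply: intr_ler_sqr; rewrite rpredN.
set c := a - b%:R in h3 h4 *; have -> : a - m = c - (m - b%:R) by rewrite /c; ring.
move: (m - b%:R) k1 k2 => d k1 k2; nra.
Qed.

(** The candidates obtained by rounding each coordinate down or up are finite in
    number, and one of them is as close as any given lattice point. *)
Lemma exists_nearest x : E x -> exists2 v, A' v & voronoi_cell v x.
Proof.
move=> xE.
pose z S : 'rV[R]_q := \row_i ((Num.floor (x 0 i))%:~R + (i \in S)%:R).
have zZ S : int_row (z S).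
  by move=> i; rewrite mxE rpredD ?intr_int ?natr_int.
have zA S : A' (centered (z S)) by apply/dual_root_latticeP; exists (z S).
have [S0 _ hS0] := @arg_minP _ _ _ finset.set0 xpredT (fun S => sq (x - centered (z S))) isT.
exists (centered (z S0)) => //; apply/voronoi_cellP; split=> // w /dual_root_latticeP[y yZ ->].
(* After a diagonal shift of [y] the mean [c] of [x - y] is between [-1/2] and
   [1/2], so [sq (x - centered y)] is the sum of the squares of the [x i - y i - c]
   and each of these decreases when [y i] is rounded. *)
pose m := tot (x - y) / q%:R.
pose k : R := (Num.floor (m + 1 / 2))%:~R.
pose y' := y + const_mx k; pose c := m - k.
have y'Z : int_row y'.
  by apply: int_rowD => // i; rewrite mxE intr_int.
have -> : centered y = centered y' by rewrite centeredD centered_const addr0.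
have cb : - (1 / 2) <= c <= 1 / 2.
  have := floor_itv (m + 1 / 2); rewrite intrD -/k /c; lra.
have var (u : 'rV[R]_q) : sq (x - centered u) <= sq (x - u - const_mx c).
  rewrite -{1}(centeredK xE) -centeredN -centeredD sq_centered [X in _ <= X]sqB {3}/sq.
  rewrite dotC !dot_const tot_const.
  suff : 0 <= (tot (x - u) - c * q%:R) ^+ 2 / q%:R.
    have -> : (tot (x - u) - c * q%:R) ^+ 2 / q%:R =
      tot (x - u) ^+ 2 / q%:R - 2 * (c * tot (x - u)) + c * (c * q%:R).
      by field; exact: qR0.
    lra.
  by rewrite divr_ge0 ?sqr_ge0 // ler0n.
have vareq : sq (x - centered y') = sq (x - y' - const_mx c).
  rewrite -{1}(centeredK xE) -centeredN -centeredD sq_centered [RHS]sqB {3}/sq.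
  rewrite dotC !dot_const tot_const /y' opprD addrA totD totN tot_const.
  by rewrite /c /m; field; exact: qR0.
pose S' := [set i | 1 / 2 < x 0 i - (Num.floor (x 0 i))%:~R - c]%SET.
apply: (le_trans (hS0 S' isT)); apply: (le_trans (var _)); rewrite vareq.
apply: ler_sum => i _; rewrite -!expr2 !mxE inE.
set f := Num.floor (x 0 i); set b : R := (_ < _)%R%:R.
have hi : y' 0 i - f%:~R \is a Num.int by rewrite rpredB // intr_int.
have := floor_itv (x 0 i); rewrite intrD -/f => /andP[f1 f2].
have : (x 0 i - f%:~R - c - b) ^+ 2 <= (x 0 i - f%:~R - c - (y' 0 i - f%:~R)) ^+ 2.
  by apply: sq_round => //; lra.
have -> : y' 0 i = y 0 i + k by rewrite !mxE.
by congr (is_true (_ <= _)); congr (_ ^+ 2); ring.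
Qed.

End Lattice.

Section Cell.
Variables (R : realType) (q : nat).
Hypothesis q0 : (0 < q)%N.
Implicit Types (u v w x y z t : 'rV[R]_q) (S T : {set 'I_q}) (s : 'S_q).

Local Notation E := (hyperplane0 R q).
Local Notation A := (root_lattice R q).
Local Notation A' := (dual_root_lattice R q).
Let qR := @qR0 R q q0.
Let qRp := @qR_gt0 R q q0.

(** * The inequalities of a cell *)

Definition ind S : 'rV[R]_q := \row_i (i \in S)%:R.

Definition psum u S : R := dot (ind S) u.

Definition cell_bound (k : nat) : R := k%:R * (q%:R - k%:R) / (2 * q%:R).

Definition cell u : Prop := E u /\ forall S, psum u S <= cell_bound #|S|.

Definition tight u S : bool := psum u S == cell_bound #|S|.

Lemma psumE u S : psum u S = \sum_(i in S) u 0 i.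
Proof.
rewrite big_mkcond; apply: eq_bigr => i _; rewrite mxE.
by case: ifP; rewrite ?mul1r ?mul0r.
Qed.

Lemma tot_ind S : tot (ind S) = #|S|%:R.
Proof.
rewrite /tot -sum1_card natr_sum [RHS]big_mkcond; apply: eq_bigr => i _.
by rewrite mxE; case: ifP.
Qed.

Lemma sq_ind S : sq (ind S) = #|S|%:R.
Proof.
by rewrite -tot_ind; apply: eq_bigr => i _; rewrite mxE; case: (_ \in _); rewrite ?mul1r ?mul0r.
Qed.

Lemma ind_const : ind finset.setT = const_mx 1.
Proof. by apply/rowP => i; rewrite !mxE inE. Qed.

Lemma ind0 : ind finset.set0 = 0.
Proof. by apply/rowP => i; rewrite !mxE inE. Qed.

Lemma psum0 u : psum u finset.set0 = 0.
Proof. by rewrite /psum ind0 dot0l. Qed.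

Lemma ind_dual S : A' (centered (ind S)).
Proof.
by apply/(dual_root_latticeP q0); exists (ind S) => // i; rewrite mxE natr_int.
Qed.

Lemma tight_set0 u : tight u finset.set0.
Proof. by rewrite /tight psum0 cards0 /cell_bound !mul0r. Qed.

(** The cell inequality for [S] is half of [0 <= excess u (ind S)]. *)
Definition excess u z : R := sq (u - centered z) - sq u.

Lemma excess_ind u S : E u -> excess u (ind S) = 2 * (cell_bound #|S| - psum u S).
Proof.
move=> uE; rewrite /excess sqB dotC dot_centeredl // -/(psum u S) sq_centered // sq_ind tot_ind /cell_bound.
by field; exact: qR.
Qed.

Lemma excessD u x y : E u ->
  excess u (x + y) = excess u x + excess u y + 2 * (dot x y - tot x * tot y / q%:R).
Proof.
move=> uE; have h : dot (centered x) (centered y) = dot x y - tot x * tot y / q%:R.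
  rewrite dot_centeredl; last exact: centered_hyperplane.
  by rewrite dotC dotDl dotNl dot_const dotC; ring.
rewrite /excess centeredD opprD -h addrA; rewrite !(sqB _ (centered y)) !sqB !dotE.
by ring.
Qed.

(** Peeling off the indicator of the support: [m] is the sum of the indicator of
    its support [S] and of a smaller function with support in [S], and the
    cross term of their excesses is nonnegative.  It vanishes only when [S] is
    everything, which does not change the projection, or when nothing is left. *)
Lemma excess_nat u (m : 'I_q -> nat) : cell u -> let z := \row_i (m i)%:R in
  0 <= excess u z /\ (excess u z = 0 -> exists2 S, tight u S & centered z = centered (ind S)).
Proof.
move=> [uE uS]; move: {2}(\sum_i m i)%N (leqnn (\sum_i m i)%N) => n.
elim: n m => [|n IH] m hm z; pose S := [set i | (0 < m i)%N]%SET.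
  have -> : z = ind finset.set0.
    apply/rowP => i; rewrite !mxE inE; congr (_%:R); apply/eqP.
    by move: hm; rewrite leqn0 sum_nat_eq0 => /forallP/(_ i).
  rewrite excess_ind // (eqP (tight_set0 u)) subrr mulr0; split=> // _.
  by exists finset.set0; rewrite ?tight_set0.
pose z' : 'rV[R]_q := \row_i (m i).-1%:R.
have zE : z = ind S + z'.
  apply/rowP => i; rewrite !mxE inE -natrD; congr (_%:R).
  by case: (m i).
have hm' S' : S = S' -> S' != finset.set0 -> (\sum_i (m i).-1 <= n)%N.
  move=> <- /finset.set0Pn[i iS]; rewrite -ltnS; apply: leq_trans hm.
  rewrite [X in (_ < X)%N](bigD1 i) //= (bigD1 i) //= -addSn.
  apply: leq_add; first by move: iS; rewrite inE; lia.
  by apply: leq_sum => j _; lia.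
have [S0|Sn0] := eqVneq S finset.set0.
  apply: (IH m _); rewrite [X in (X <= _)%N](_ : _ = 0%N) //; apply/eqP.
  rewrite sum_nat_eq0; apply/forallP => i; apply/implyP => _.
  by have := finset.in_set0 i; rewrite -S0 inE; lia.
have /= [h1 h2] := IH _ (hm' _ erefl Sn0); rewrite -/z' in h1 h2.
have [ST|SnT] := eqVneq S finset.setT.
  have e : centered z = centered z' by rewrite zE ST ind_const centeredD centered_const // add0r.
  by rewrite /excess e.
have sq : (#|S| < q)%N.
  by rewrite -[X in (_ < X)%N](card_ord q) -cardsT proper_card // properT.
have tz : 0 <= tot z' by apply: sumr_ge0 => i _; rewrite mxE ler0n.
have dz : dot (ind S) z' = tot z'.
  apply: eq_bigr => i _; rewrite !mxE inE; case: (m i) => [|k] /=.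
    by rewrite mul0r.
  by rewrite mul1r.
have c1 : 0 < 1 - #|S|%:R / q%:R :> R by rewrite subr_gt0 ltr_pdivrMr // mul1r ltr_nat.
have ex : excess u z = 2 * (cell_bound #|S| - psum u S) + excess u z' + 2 * (tot z' * (1 - #|S|%:R / q%:R)).
  by rewrite zE excessD // excess_ind // dz tot_ind; ring.
have g0 := uS S; have p0 : 0 <= tot z' * (1 - #|S|%:R / q%:R) by apply: mulr_ge0 => //; exact: ltW.
rewrite ex; split=> [|h]; first by lra.
have tight_S : tight u S by apply/eqP; lra.
have /eqP : tot z' * (1 - #|S|%:R / q%:R) = 0 by lra.
rewrite mulf_eq0 (gt_eqF c1) orbF psumr_eq0 => [/allP z'0|i _]; last by rewrite mxE ler0n.
exists S => //; rewrite zE; congr centered; apply/rowP => i; rewrite mxE.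
by rewrite (eqP (z'0 i (mem_index_enum _))) addr0.
Qed.

(** Constant vectors have projection [0], so an integral vector can be made
    nonnegative without changing its projection. *)
Lemma cell_dist u w : cell u -> A' w -> sq u <= sq (u - w) /\
  (sq (u - w) = sq u -> exists2 S, tight u S & w = centered (ind S)).
Proof.
move=> uc /(dual_root_latticeP q0)[z zZ ->].
pose c := \sum_j `|z 0 j|; pose m i := Num.truncn (z 0 i + c).
have zm : centered z = centered (\row_i (m i)%:R).
  rewrite (_ : (\row_i _) = z + const_mx c) ?centeredD ?centered_const ?addr0 //.
  apply/rowP => i; rewrite !mxE /m truncnK //; rewrite -intrEge0.
    rewrite rpredD //; apply: rpred_sum => j _.
    by apply: intr_nat; rewrite natr_norm_int.
  rewrite /c (bigD1 i) //= addrA addr_ge0 //; last by apply: sumr_ge0.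
  by have := ler_norm (- z 0 i); rewrite normrN; lra.
have := @excess_nat u m uc; rewrite /= /excess -zm => -[h1 h2].
split; first by rewrite -subr_ge0.
by move=> h; apply: h2; rewrite h subrr.
Qed.

Lemma voronoi0P u : voronoi_cell 0 u <-> cell u.
Proof.
split=> [/voronoi_cellP[uE h]|uc]; last first.
  apply/voronoi_cellP; split; first by case: uc.
  by move=> w /(cell_dist uc)[]; rewrite subr0.
split=> // S; have := h _ (ind_dual S); rewrite subr0 -subr_ge0 -/(excess u _) excess_ind //.
by lra.
Qed.

Lemma voronoi_cell_shift v x : A' v -> voronoi_cell v x <-> cell (x - v).
Proof. by move=> vA; rewrite -{1}[v]add0r voronoi_cell_translate // voronoi0P. Qed.

Lemma voronoi_tight u S : cell u -> voronoi_cell (centered (ind S)) u <-> tight u S.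
Proof.
move=> uc; have u0 := (voronoi0P u).2 uc; split=> [h|/eqP h].
  have := voronoi_sq_eq u0 h (dual0 R q0) (ind_dual S); rewrite subr0 => e.
  have := excess_ind S uc.1; rewrite /excess -e subrr => h'; apply/eqP; lra.
apply: voronoi_cell_sq u0 _; have := excess_ind S uc.1; rewrite /excess h subr0; lra.
Qed.

Lemma voronoi_tightP u w : cell u -> A' w ->
  voronoi_cell w u -> exists2 S, tight u S & w = centered (ind S).
Proof.
move=> uc wA uw; apply: (cell_dist uc wA).2.
have u0 := (voronoi0P u).2 uc.
by rewrite -(voronoi_sq_eq u0 uw (dual0 R q0) wA) subr0.
Qed.

Lemma ind_UI S T : ind (S :|: T) + ind (S :&: T) = ind S + ind T.
Proof.
apply/rowP => i; rewrite !mxE !inE.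
by case: (i \in S); case: (i \in T); rewrite /= ?addr0 ?add0r.
Qed.

(** [psum u] is modular in [S] whereas the bound, a strictly concave function of
    the cardinality, is strictly submodular on incomparable sets. *)
Lemma tight_nested u S T : cell u -> tight u S -> tight u T ->
  (S \subset T) || (T \subset S).
Proof.
move=> [_ uS] /eqP hS /eqP hT; apply/negPn; rewrite negb_or -!finset.setD_eq0 -!cards_eq0.
rewrite -!lt0n; apply/negP => /andP[a0 b0].
have hU := uS (S :|: T)%SET; have hI := uS (S :&: T)%SET.
have e : psum u (S :|: T) + psum u (S :&: T) = psum u S + psum u T.
  by rewrite /psum -!dotDl ind_UI.
have := cardsID T S; have := cardsID S T; have := cardsUI S T.
rewrite (finset.setIC T S).
move: hU hI hS hT e a0 b0.
move: #|(S :|: T)%SET| #|(S :&: T)%SET| #|(S :\: T)%SET| #|(T :\: S)%SET| #|S| #|T|.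
move=> U I a b s t hU hI hS hT e a0 b0 eU et es.
have k : cell_bound s + cell_bound t - cell_bound U - cell_bound I = a%:R * b%:R / q%:R.
  have -> : U = (I + a + b)%N by lia.
  rewrite -es -et /cell_bound !natrD; field; exact: qR.
have : 0 < a%:R * b%:R / q%:R :> R by rewrite divr_gt0 // mulr_gt0 // ltr0n.
by lra.
Qed.

(** * Moving along an edge direction *)

Definition edge_dir (i j : 'I_q) : 'rV[R]_q := delta_mx 0 i - delta_mx 0 j.

Lemma psum_edge (c : R) u i j S :
  psum (u + c *: edge_dir i j) S = psum u S + c * ((i \in S)%:R - (j \in S)%:R).
Proof. by rewrite /psum !dotE ![dot _ (delta_mx _ _)]dotC !dot_delta !mxE. Qed.

Lemma edge_dir_hyperplane i j : E (edge_dir i j).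
Proof. by rewrite /hyperplane0 /= -/(tot _) totD totN !tot_delta subrr. Qed.

(** Moving along [e_i - e_j] only affects the sets that separate [i] from [j];
    the least slack among those that contain [i] tells when to stop. *)
Lemma cell_push u i j : cell u -> i != j ->
  (forall S, tight u S -> (i \in S) = (j \in S)) ->
  exists e : R, [/\ 0 < e, cell (u + e *: edge_dir i j),
    forall S, tight u S -> tight (u + e *: edge_dir i j) S &
    exists2 S, tight (u + e *: edge_dir i j) S & ~~ tight u S].
Proof.
move=> [uE uS] ij hS.
pose P S := (i \in S) && (j \notin S).
have Pi : P [set i]%SET by rewrite /P !inE eqxx eq_sym.
have [T /andP[iT jT] hT] := @arg_minP _ _ _ [set i]%SET P (fun S => cell_bound #|S| - psum u S) Pi.
have nT : ~~ tight u T by apply/negP => /hS; rewrite iT (negbTE jT).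
exists (cell_bound #|T| - psum u T); split.
- by rewrite subr_gt0 lt_neqAle uS andbT.
- split=> [|S].
    by apply: hyperplaneD => //; apply: hyperplaneZ; exact: edge_dir_hyperplane.
  rewrite psum_edge; have := uS S; have := uS T.
  case: (boolP (i \in S)) => iS; case: (boolP (j \in S)) => jS /=; try lra.
  by have := hT S; rewrite /P iS jS => /(_ isT); lra.
- by move=> S tS; rewrite /tight psum_edge (hS S tS) subrr mulr0 addr0.
- exists T => //; rewrite /tight psum_edge iT (negbTE jT) subr0 mulr1.
  by apply/eqP; ring.
Qed.

End Cell.

Section Vertices.
Variables (R : realType) (q : nat).
Hypothesis q0 : (0 < q)%N.
Implicit Types (u v w x y z t : 'rV[R]_q) (S T : {set 'I_q}) (s : 'S_q).

Local Notation E := (hyperplane0 R q).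
Local Notation A := (root_lattice R q).
Local Notation A' := (dual_root_lattice R q).
Let qR := @qR0 R q q0.
Let qRp := @qR_gt0 R q q0.

(** * Permutations as vertices of the central cell *)

(** The permutation [s + 1] of [1 .. q], centered and divided by [q]. *)
Definition vtx s : 'rV[R]_q := \row_i (((s i)%:R + 1 / 2) / q%:R - 1 / 2).

Definition upper s (r : 'I_q) : {set 'I_q} := [set i | (r < s i)%N]%SET.

Definition site s r : 'rV[R]_q := centered (ind R (upper s r)).

Lemma sum_ltn (n k : nat) : (\sum_(j < n) (j < k) = minn n k)%N.
Proof.
elim: n => [|n IH]; first by rewrite big_ord0 min0n.
by rewrite big_ord_recr /= IH; lia.
Qed.

Lemma sum_below s k : (k <= q)%N -> (\sum_j (s j < k) = k)%N.
Proof.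
move=> kq; rewrite -[RHS](minn_idPr kq) -sum_ltn.
by rewrite [RHS](reindex_inj (@perm_inj _ s)).
Qed.

Lemma card_upper s r : #|upper s r| = (q - r.+1)%N.
Proof.
have := cardsC (upper s r); rewrite card_ord => e.
suff c : #|~: upper s r|%SET = r.+1 by rewrite c in e; lia.
rewrite -[RHS](sum_below s (ltn_ord r)) -sum1_card big_mkcond.
by apply: eq_bigr => i _; rewrite !inE -leqNgt ltnS; case: leqP.
Qed.

Lemma siteE s r i : site s r 0 i = (r < s i)%N%:R - (q - r.+1)%:R / q%:R.
Proof. by rewrite centeredE tot_ind card_upper mxE inE. Qed.

(** The number of pairs that keep [S] from consisting of the largest values. *)
Definition inversions s S := (\sum_(i in S) \sum_(j in ~: S) (s i < s j))%N.

(** The value [s i] counts the [j] with [s j < s i].  Among the pairs of [S * S]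
    half of those off the diagonal are counted, and among the pairs from [S] to
    its complement all but the inversions. *)
Lemma sum_values s S :
  (2 * (\sum_(i in S) s i) + 2 * inversions s S + #|S| * #|S| + #|S| = 2 * #|S| * q)%N.
Proof.
pose a := (\sum_(i in S) \sum_(j in S) (s j < s i))%N.
pose b := (\sum_(i in S) \sum_(j in ~: S) (s j < s i))%N.
have -> : (\sum_(i in S) s i = a + b)%N.
  rewrite -big_split; apply: eq_bigr => i iS /=.
  rewrite -{1}(sum_below s (ltnW (ltn_ord (s i)))) (bigID (mem S)) /=.
  by congr (_ + _)%N; apply: eq_bigl => j; rewrite !inE.
have hb : (b + inversions s S = #|S| * #|~: S|%SET)%N.
  rewrite -big_split -sum_nat_const; apply: eq_bigr => i iS /=.
  rewrite -big_split -sum1_card; apply: eq_bigr => j /= jS.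
  have : s i != s j by rewrite (inj_eq perm_inj); apply: contraTneq jS => <-; rewrite inE iS.
  by rewrite -val_eqE /=; lia.
have ha : (2 * a + #|S| = #|S| * #|S|)%N.
  have -> : (2 * a = a + \sum_(i in S) \sum_(j in S) (s i < s j))%N.
    by rewrite [X in (_ + X)%N]exchange_big /= -/a; lia.
  rewrite -{1}sum1_card -!big_split -sum_nat_const; apply: eq_bigr => i iS /=.
  rewrite -big_split /= (bigD1 i) //= ltnn /= add0n addn1.
  rewrite (eq_bigr (fun=> 1%N)) => [|j /andP[_ ji]].
    by rewrite sum1_card [in RHS](cardD1 i) iS add1n; congr _.+1; apply: eq_card => j; rewrite !inE andbC.
  have : s i != s j by rewrite (inj_eq perm_inj) eq_sym.
  by rewrite -val_eqE /=; lia.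
have hc : (2 * #|S| * q = 2 * #|S| * (#|S| + #|~: S|%SET))%N by rewrite cardsC card_ord.
by rewrite hc; move: ha hb; move: #|S| #|~: S|%SET (inversions s S) => c d e ha hb; nia.
Qed.

Lemma psum_vtx s S : cell_bound R q #|S| - psum (vtx s) S = (inversions s S)%:R / q%:R.
Proof.
have -> : psum (vtx s) S = ((\sum_(i in S) s i)%N%:R + #|S|%:R / 2) / q%:R - #|S|%:R / 2.
  rewrite psumE (eq_bigr (fun i => (s i)%:R / q%:R + (1 / 2 / q%:R - 1 / 2))) => [|i _]; last first.
    by rewrite mxE; ring.
  rewrite big_split /= -mulr_suml -natr_sum sumr_const -[in LHS]mulr_natr.
  by field; exact: qR.
have := sum_values s S; move/(congr1 (fun n : nat => n%:R : R)); rewrite !natrD !natrM.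
move: (\sum_(i in S) s i)%N (inversions s S) #|S| => a b c.
move=> h; rewrite /cell_bound; have -> : (b%:R : R) = c%:R * q%:R - a%:R - c%:R * c%:R / 2 - c%:R / 2 by lra.
by field; exact: qR.
Qed.

Lemma vtx_cell s : cell (vtx s).
Proof.
have h S : psum (vtx s) S = cell_bound R q #|S| - (inversions s S)%:R / q%:R.
  by rewrite -psum_vtx; ring.
split=> [|S]; last by rewrite h lerBlDr lerDl divr_ge0 // ler0n.
have := h finset.setT; rewrite psumE cardsT card_ord /cell_bound subrr mulr0 mul0r.
rewrite [inversions _ _]big1 ?mul0r ?subr0 => [e|i _]; last first.
  by rewrite big1 // => j; rewrite !inE.
by rewrite /hyperplane0 /= -[RHS]e; apply: eq_bigl => i; rewrite inE.
Qed.

Lemma tight_vtx s S : tight (vtx s) S = (inversions s S == 0)%N.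
Proof.
rewrite /tight eq_sym -subr_eq0 psum_vtx mulf_eq0 invr_eq0 (negbTE qR) orbF.
by rewrite pnatr_eq0.
Qed.

Lemma tight_upper s r : tight (vtx s) (upper s r).
Proof.
rewrite tight_vtx; apply/eqP; apply: big1 => i; rewrite inE => hi.
by apply: big1 => j; rewrite !inE => hj; apply/eqP; rewrite eqb0; lia.
Qed.

Lemma tight_vtx_site s S : tight (vtx s) S -> exists r, centered (ind R S) = site s r.
Proof.
move=> hS; have [->|ST] := eqVneq S finset.setT.
  have ql : (q.-1 < q)%N by lia.
  exists (Ordinal ql); rewrite /site (_ : upper _ _ = finset.set0); last first.
    by apply/eqP; rewrite -cards_eq0 card_upper /= prednK // subnn.
  have e0 : const_mx 0 = 0 :> 'rV[R]_q by apply/rowP => i; rewrite !mxE.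
  by rewrite ind_const ind0 -[in RHS]e0 !centered_const.
have Sq : (#|S| < q)%N.
  by rewrite -[X in (_ < X)%N](card_ord q) -cardsT proper_card // properT.
have rq : (q - #|S|.+1 < q)%N by lia.
exists (Ordinal rq); rewrite /site; congr (centered (ind _ _)); apply/eqP.
have e : #|upper s (Ordinal rq)| = #|S| by rewrite card_upper subnSK // subKn // ltnW.
case/orP: (tight_nested q0 (vtx_cell s) hS (tight_upper s (Ordinal rq))) => h.
  by rewrite eqEcard h e leqnn.
by rewrite eq_sym eqEcard h e leqnn.
Qed.

(** A second difference of the bound: compare [S] with [S] minus [i] and with [S]
    plus [j]. *)
Lemma cell_sep u S i j : cell u -> tight u S -> i \in S -> j \notin S ->
  u 0 j + 1 / q%:R <= u 0 i.
Proof.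
move=> [_ uS] /eqP hS iS jS.
have := uS (S :\ i)%SET; have := uS (j |: S)%SET; move: hS.
rewrite cardsU1 jS [in cell_bound R q #|S|](cardsD1 i) iS (cardsD1 i S) iS !add1n !psumE.
rewrite big_setU1 //= (big_setD1 i) //=; move: #|_| (\sum_(_ in _) _) => k a e h1 h2.
have g : cell_bound R q k.+1 + cell_bound R q k.+1 - cell_bound R q k - cell_bound R q k.+2 = 1 / q%:R.
  by rewrite /cell_bound -!natr1; field; exact: qR.
lra.
Qed.

Lemma cell_lower u i : cell u -> 1 / (2 * q%:R) - 1 / 2 <= u 0 i.
Proof.
move=> [uE uS]; have := uS (~: [set i])%SET; rewrite cardsC1 card_ord psumE.
have := uE; rewrite /hyperplane0 /= (bigD1 i) //= => e.
rewrite (eq_bigl (fun j => j != i)) => [|j]; last by rewrite !inE.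
have -> : cell_bound R q q.-1 = 1 / 2 - 1 / (2 * q%:R).
  have e1 : q.-1%:R = q%:R - 1 :> R by rewrite -[in RHS](prednK q0) -natr1 addrK.
  by rewrite /cell_bound e1; field; exact: qR.
lra.
Qed.

Lemma cell_upper u i : cell u -> u 0 i <= 1 / 2 - 1 / (2 * q%:R).
Proof.
move=> [_ uS]; have := uS [set i]%SET; rewrite cards1 psumE big_set1 /cell_bound.
have -> // : 1%:R * (q%:R - 1%:R) / (2 * q%:R) = 1 / 2 - 1 / (2 * q%:R) :> R.
by field; exact: qR.
Qed.

Lemma separated_vtx u : cell u ->
  (forall i j, i != j -> exists2 S, tight u S & (i \in S) != (j \in S)) ->
  exists s, u = vtx s.
Proof.
move=> uc sep.
have far i j : u 0 j < u 0 i -> u 0 j + 1 / q%:R <= u 0 i.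
  move=> ji; have /sep[S tS] : i != j by apply: contraTneq ji => ->; rewrite ltxx.
  case: (boolP (i \in S)) => iS; case: (boolP (j \in S)) => jS // _.
    exact: cell_sep tS iS jS.
  have := cell_sep uc tS jS iS; have : 0 < 1 / q%:R :> R by rewrite divr_gt0.
  by lra.
have tot_order i j : i != j -> (u 0 i < u 0 j) || (u 0 j < u 0 i).
  move=> /sep[S tS]; have : 0 < 1 / q%:R :> R by rewrite divr_gt0.
  case: (boolP (i \in S)) => iS; case: (boolP (j \in S)) => jS // h _.
    by have := cell_sep uc tS iS jS => h'; apply/orP; right; lra.
  by have := cell_sep uc tS jS iS => h'; apply/orP; left; lra.
pose D i := [set j | u 0 j < u 0 i]%SET.
have Dq i : (#|D i| < q)%N.
  rewrite -[X in (_ < X)%N](card_ord q) -cardsT; apply: proper_card.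
  by rewrite properT; apply/negP => /eqP/setP/(_ i); rewrite !inE ltxx.
have Dlt i j : u 0 i < u 0 j -> (#|D i| < #|D j|)%N.
  move=> ij; apply: proper_card; apply/fintype.properP; split.
    by apply/fintype.subsetP => k; rewrite !inE => /lt_trans; apply.
  by exists i; rewrite !inE ?ltxx.
pose f i := Ordinal (Dq i).
have f_inj : injective f.
  move=> i j /(congr1 val) /= e; apply/eqP/negPn/negP => /tot_order.
  by case/orP => /Dlt; rewrite e ltnn.
exists (perm f_inj).
(* Coordinates are at least [1 / q] apart, which bounds each of them from below
   according to its rank; the bounds have sum [0], so they are attained. *)
have low i : vtx (perm f_inj) 0 i <= u 0 i.
  rewrite mxE permE /=; have [n] := ubnP #|D i|; elim: n i => // n IH i /ltnSE hn.
  have [D0|/finset.set0Pn[k kD]] := eqVneq (D i) finset.set0.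
    rewrite D0 cards0; have := cell_lower i uc.
    have -> // : (0%:R + 1 / 2) / q%:R - 1 / 2 = 1 / (2 * q%:R) - 1 / 2 :> R.
    by field; exact: qR.
  rewrite inE in kD; have [j ji jmax] := @arg_maxP _ _ _ k (fun l => u 0 l < u 0 i) (u 0) kD.
  have Dij : D i = (j |: D j)%SET.
    apply/setP => l; rewrite !inE; apply/idP/orP => [li|[/eqP ->//|/lt_trans]]; last exact.
    have [->|lj] := eqVneq l j; first by left.
    right; have := jmax l li.
    by case/orP: (tot_order _ _ lj) => // h1 h2; have := lt_le_trans h1 h2; rewrite ltxx.
  have ce : #|D i| = #|D j|.+1 by rewrite Dij cardsU1 inE ltxx.
  have := IH j; rewrite -ce => /(_ hn) h; rewrite ce -natr1.
  have := far _ _ ji.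
  have -> : (#|D j|%:R + 1 + 1 / 2) / q%:R - 1 / 2 = (#|D j|%:R + 1 / 2) / q%:R - 1 / 2 + 1 / q%:R :> R.
    by ring.
  lra.
have s0 : \sum_i (u 0 i - vtx (perm f_inj) 0 i) = 0.
  by rewrite sumrB; have := uc.1; have := (vtx_cell (perm f_inj)).1; rewrite /hyperplane0 /= => -> ->; rewrite subrr.
apply/rowP => i; apply/eqP; rewrite -subr_eq0.
move/eqP: s0; rewrite psumr_eq0 => [/allP h|j _]; last by rewrite subr_ge0.
exact: h (mem_index_enum _).
Qed.

Lemma hull_segment (I : finType) (p : I -> 'rV[R]_q) (c : R) x y :
  0 <= c <= 1 -> convex_hull p x -> convex_hull p y ->
  convex_hull p (c *: x + (1 - c) *: y).
Proof.
move=> /andP[c0 c1] [a [a0 a1 ->]] [b [b0 b1 ->]].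
exists (fun i => c * a i + (1 - c) * b i); split.
- by move=> i; rewrite addr_ge0 // mulr_ge0 // subr_ge0.
- by rewrite big_split /= -!mulr_sumr a1 b1; ring.
- rewrite !scaler_sumr -big_split /=; apply: eq_bigr => i _.
  by rewrite !scalerA -scalerDl.
Qed.

(** A point that is not a vertex lies between two points with more tight sets. *)
Lemma cell_hull u : cell u -> convex_hull vtx u.
Proof.
have [n] := ubnP #|[set S | ~~ tight u S]%SET|; elim: n u => // n IH u /ltnSE hn uc.
have [/existsP[[i j] /= /andP[ij /forallP hS]]|] := boolP [exists ij : 'I_q * 'I_q,
    (ij.1 != ij.2) && [forall S, tight u S ==> ((ij.1 \in S) == (ij.2 \in S))]]; last first.
  move=> /existsPn h; have [|s ->] := separated_vtx uc.
    move=> i j ij; have /= := h (i, j); rewrite ij /= => /forallPn[S].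
    by rewrite negb_imply => /andP[tS iS]; exists S.
  exists (fun s' => (s' == s)%:R); split=> [s'||]; first by rewrite ler0n.
    by rewrite (bigD1 s) //= eqxx big1 ?addr0 // => s' /negbTE ->.
  by rewrite (bigD1 s) //= eqxx scale1r big1 ?addr0 // => s' /negbTE ->; rewrite scale0r.
have less x S0 : (forall S, tight u S -> tight x S) -> tight x S0 -> ~~ tight u S0 ->
    (#|[set S | ~~ tight x S]%SET| < n)%N.
  move=> ux h1 h2; apply: leq_trans hn; apply: proper_card; apply/fintype.properP; split.
    by apply/fintype.subsetP => S; rewrite !inE; apply: contra => /ux.
  by exists S0; rewrite !inE ?h1 ?h2.
have hij S : tight u S -> (i \in S) = (j \in S) by move=> tS; have := hS S; rewrite tS => /eqP.
have [e1 [e1p c1 k1 [S1 t1 n1]]] := cell_push uc ij hij.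
have [|e2 [e2p c2 k2 [S2 t2 n2]]] := cell_push uc (_ : j != i) (fun S tS => esym (hij S tS)).
  by rewrite eq_sym.
have e12 : 0 < e1 + e2 by rewrite addr_gt0.
pose c := e2 / (e1 + e2).
have -> : u = c *: (u + e1 *: edge_dir R i j) + (1 - c) *: (u + e2 *: edge_dir R j i).
  apply/rowP => k; rewrite !mxE /c; field; exact: lt0r_neq0.
apply: hull_segment; [|by apply: IH => //; apply: less t1 n1|by apply: IH => //; apply: less t2 n2].
by rewrite /c divr_ge0 ?(ltW e2p) ?(ltW e12) // ler_pdivrMr // mul1r lerDr ltW.
Qed.

Lemma cell_combination (w : 'S_q -> R) S : \sum_s w s = 1 ->
  cell_bound R q #|S| - psum (\sum_s w s *: vtx s) S = \sum_s w s * (cell_bound R q #|S| - psum (vtx s) S).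
Proof.
move=> w1; under [RHS]eq_bigr do rewrite mulrBr.
rewrite sumrB -mulr_suml w1 mul1r; congr (_ - _); rewrite /psum dotC dot_suml.
by apply: eq_bigr => s _; rewrite dotZl dotC.
Qed.

Lemma hull_cell u : convex_hull vtx u -> cell u.
Proof.
move=> [w [w0 w1 ->]]; split=> [|S].
  rewrite /hyperplane0 /= -/(tot _) tot_sum big1 // => s _; rewrite totZ.
  by have := (vtx_cell s).1; rewrite /hyperplane0 /tot /= => ->; rewrite mulr0.
rewrite -subr_ge0 cell_combination //; apply: sumr_ge0 => s _.
by rewrite mulr_ge0 // subr_ge0; case: (vtx_cell s).
Qed.

(** A vertex with positive weight in a convex combination equal to [u] satisfies
    with equality all the inequalities that [u] does. *)
Lemma cell_vertex u : cell u -> exists s, forall S, tight u S -> tight (vtx s) S.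
Proof.
move=> uc; have [w [w0 w1 uE]] := cell_hull uc.
have [s ws] : exists s, w s != 0.
  case: (boolP [exists s, w s != 0]) => [/existsP//|/existsPn h].
  have : (1 : R) = 0 by rewrite -w1 big1 // => s _; apply/eqP/negPn/h.
  by move/eqP; rewrite oner_eq0.
exists s => S /eqP hS; have := cell_combination S w1; rewrite -uE hS subrr.
move=> /esym/eqP; rewrite psumr_eq0 => [/allP/(_ s (mem_index_enum _))|s' _]; last first.
  by rewrite mulr_ge0 // subr_ge0; case: (vtx_cell s').
by rewrite mulf_eq0 (negbTE ws) /= subr_eq0 eq_sym.
Qed.

End Vertices.

Section Faces.
Variables (R : realType) (q : nat).
Hypothesis q0 : (0 < q)%N.
Implicit Types (v w x y z t : 'rV[R]_q) (S T J : {set 'I_q}) (s u : 'S_q).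

Local Notation E := (hyperplane0 R q).
Local Notation A := (root_lattice R q).
Local Notation A' := (dual_root_lattice R q).
Local Notation site := (@site R q).
Local Notation vtx := (@vtx R q).
Let qR := @qR0 R q q0.
Let qRp := @qR_gt0 R q q0.

(** * Lattice points around a vertex *)

Lemma site_dual s r : A' (site s r). Proof. exact: ind_dual. Qed.

Lemma vtx_voronoi s r : voronoi_cell (site s r) (vtx s).
Proof. by apply/voronoi_tight => //; [exact: vtx_cell|exact: tight_upper]. Qed.

Lemma voronoi_vtxP s w : A' w -> voronoi_cell w (vtx s) -> exists r, w = site s r.
Proof.
move=> wA /(voronoi_tightP q0 (vtx_cell R q0 s) wA)[S tS ->].
exact: (tight_vtx_site q0).
Qed.

Lemma voronoi_translate t v x : A t ->
  voronoi_cell (v + t) (x + t) <-> voronoi_cell v x.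
Proof. by move=> /(root_dual q0) tA; rewrite voronoi_cell_translate // addrK. Qed.

Lemma site_subE s u a i : (site s a - site u a) 0 i = (a < s i)%N%:R - (a < u i)%N%:R.
Proof.
rewrite rowBE !siteE //.
by ring.
Qed.

Lemma int_small (c : R) : c \is a Num.int -> `|c| < 1 -> c = 0.
Proof.
move=> cZ c1; apply/eqP/negPn/negP => /(norm_intr_ge1 cZ).
by rewrite leNgt c1.
Qed.

(** The coordinates of [site s a] are congruent modulo [1] to
    [(a + 1) / q]. *)
Lemma site_class s u a b : A (site s a - site u b) -> a = b.
Proof.
move=> /(root_latticeP q0)[_ /(_ (Ordinal q0))].
rewrite rowBE !siteE //.
set c := (_ < _)%N; set d := (_ < _)%N => h.
have : (a%:R - b%:R) / q%:R \is a @Num.int R.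
  have -> : (a%:R - b%:R) / q%:R = c%:R - (q - a.+1)%:R / q%:R
      - (d%:R - (q - b.+1)%:R / q%:R) - c%:R + d%:R :> R.
    by rewrite !natrB ?ltn_ord // -!natr1; field; exact: qR.
  by rewrite rpredD ?natr_int // rpredB ?natr_int.
move=> /int_small e; apply/val_inj/eqP => /=; rewrite -(eqr_nat R) -subr_eq0.
have /eqP : (a%:R - b%:R) / q%:R = 0 :> R.
  apply: e; rewrite normrM [X in _ * X]ger0_norm; last by rewrite invr_ge0 ler0n.
  rewrite ltr_pdivrMr // mul1r ltr_norml.
  have := ltn_ord a; have := ltn_ord b; rewrite -!(ltr_nat R).
  by have := ler0n R a; have := ler0n R b; lra.
by rewrite mulf_eq0 invr_eq0 (negbTE qR) orbF.
Qed.

Lemma root_class s v : A' v -> exists r, A (v - site s r).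
Proof.
move=> vA; have := vA => /(dual_root_latticeP q0)[z zZ ve].
have /intrP[m zm] := int_row_tot zZ.
have qz : (q : int) != 0 by rewrite eqz_nat -lt0n.
pose k := ((- 1 - m) %% q)%Z.
have kq : (`|k| < q)%N by have := modz_ge0 (- 1 - m) qz; have := ltz_pmod (- 1 - m) (_ : (0 < q%:Z)); rewrite -/k; lia.
exists (Ordinal kq); apply/(root_latticeP q0); split.
  by apply: hyperplaneD; [|apply: hyperplaneN]; apply: dual_hyperplane => //; exact: site_dual.
move=> i; rewrite ve rowBE centeredE zm siteE //.
set c : R := (_ < _)%N%:R.
have -> : z 0 i - m%:~R / q%:R - (c - (q - (Ordinal kq).+1)%:R / q%:R) =
    z 0 i - c + 1 + ((- 1 - m) %/ q)%Z%:~R.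
  have kE : (`|k|%N%:R : R) = - 1 - m%:~R - ((- 1 - m) %/ q)%Z%:~R * q%:R.
    have kk : k = `|k|%N%:Z by have := modz_ge0 (- 1 - m) qz; rewrite -/k; lia.
    have e : (- 1 - m)%:~R = (((- 1 - m) %/ q)%Z * q + `|k|%N%:Z)%:~R :> R.
      by rewrite -kk -divz_eq.
    by move: e; rewrite !intrD intrM !mulrNz; lra.
  by rewrite natrB //= -natr1 kE; field; exact: qR.
have cZ : c \is a Num.int by apply: natr_int.
by rewrite rpredD ?intr_int // rpredD ?int_num1 // rpredB.

Qed.

(** Seen from another of its cells, a vertex of the central cell is again a
    vertex of the central cell: the values are shifted cyclically. *)
Lemma vtx_rotate s r : exists s', vtx s - site s r = vtx s'.
Proof.
pose g (x : 'I_q) := (if r < x then x - r.+1 else x + (q - r.+1))%N.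
have gq (x : 'I_q) : (g x < q)%N.
  by rewrite /g; case: ifP => h; have := ltn_ord r; have := ltn_ord x; lia.
pose f i := Ordinal (gq (s i)).
have f_inj : injective f.
  move=> i j /(congr1 val) /= h; apply/(@perm_inj _ s)/val_inj; move: h.
  by rewrite /g /=; do 2 case: ifP => ?; have := ltn_ord r; have := ltn_ord (s i); have := ltn_ord (s j); lia.
exists (perm f_inj); apply/rowP => i; rewrite rowBE siteE // !mxE permE /=.
rewrite /g; case: ltnP => h /=.
  by rewrite !natrB ?ltn_ord // -[r.+1%:R]natr1; field; exact: qR.
by rewrite natrD natrB ?ltn_ord // -[r.+1%:R]natr1; field; exact: qR.
Qed.

Lemma vtx_translate s v : A' v -> exists s' t, A t /\ vtx s + v = vtx s' + t.
Proof.
move=> vA; have [r hr] := root_class s (dualN vA).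
have [s' hs'] := vtx_rotate s r.
exists s', (- (- v - site s r)); split; first exact: (root_latticeN q0 hr).
by rewrite -hs'; apply/rowP => i; rewrite !mxE; ring.
Qed.

Lemma edge_dir_root i j : A (edge_dir R i j).
Proof.
apply/(root_latticeP q0); split; first exact: edge_dir_hyperplane.
by apply: int_rowD; [|apply: int_rowN]; apply: int_row_delta.
Qed.

Lemma edge_dirE (i j k : 'I_q) : edge_dir R i j 0 k = (k == i)%:R - (k == j)%:R.
Proof. by rewrite !mxE eqxx. Qed.

(** The neighbour of a vertex in the direction that leaves the cell of index [r].
    Its own permutation exchanges the values [r] and [r + 1 mod q]; the
    translation [t] is [0] unless [r] is the last index. *)
Lemma vtx_neighbor s r : (1 < q)%N -> let s' := (s * tperm r (ordS r))%g in
  exists t, [/\ A t,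
    vtx s + (1 / q%:R) *: edge_dir R ((s^-1)%g r) ((s^-1)%g (ordS r)) = vtx s' + t,
    forall a, a != r -> site s a = site s' a + t &
    site s r != site s' r + t].
Proof.
move=> q1 s'; pose d := edge_dir R ((s^-1)%g r) ((s^-1)%g (ordS r)).
have dE i : d 0 i = (s i == r)%:R - (s i == ordS r)%:R.
  by rewrite edge_dirE -2!(inj_eq (@perm_inj _ s) i) !permKV.
have Sr := ordS_neq r q1; have := val_ordS r; have rq := ltn_ord r.
have site_eq (t : 'rV[R]_q) (a : 'I_q) : (forall i, t 0 i = (a < s i)%N%:R - (a < s' i)%N%:R) ->
    site s a = site s' a + t.
  move=> h; apply/rowP => i; by rewrite [RHS]mxE h -site_subE rowBE addrC subrK.
have site_neq (t : 'rV[R]_q) (a i : 'I_q) : t 0 i != (a < s i)%N%:R - (a < s' i)%N%:R ->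
    site s a != site s' a + t.
  apply: contra => /eqP h; by rewrite -site_subE h addrAC subrr add0r.
case: ltnP => hr vSr.
  exists 0; split; first exact: root_lattice0.
  - apply/rowP => i; rewrite mxE [_ (_ *: _) _ _]mxE -/d dE !mxE permM.
    case: tpermP => [->|->|/eqP/negbTE -> /eqP/negbTE ->].
    + by rewrite eqxx eq_sym (negbTE Sr) vSr -[r.+1%:R]natr1 /=; field; exact: qR.
    + by rewrite eqxx (negbTE Sr) vSr -[r.+1%:R]natr1 /=; field; exact: qR.
    + by rewrite /=; ring.
  - move=> a ar; apply: site_eq => i; rewrite mxE permM.
    have {}ar : a != r :> nat by rewrite val_eqE.
    case: tpermP => [->|->|_ _]; last by rewrite subrr.
      by rewrite vSr (_ : (a < r.+1)%N = (a < r)%N) ?subrr //; lia.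
    by rewrite vSr (_ : (a < r.+1)%N = (a < r)%N) ?subrr //; lia.
  - apply: (site_neq _ _ ((s^-1)%g r)); rewrite mxE permM permKV tpermL vSr ltnn ltnS leqnn.
    by rewrite sub0r eq_sym oppr_eq0 oner_eq0.
exists d; split; first exact: edge_dir_root.
- apply/rowP => i; rewrite mxE [_ (_ *: _) _ _]mxE -/d [RHS]mxE dE !mxE permM.
  have rE : r%:R = q%:R - 1 :> R.
    by rewrite [in RHS](_ : q = r.+1) -?natr1 ?addrK //; lia.
  case: tpermP => [->|->|/eqP/negbTE -> /eqP/negbTE ->].
  + by rewrite eqxx eq_sym (negbTE Sr) vSr rE /=; field; exact: qR.
  + by rewrite eqxx (negbTE Sr) vSr rE /=; field; exact: qR.
  + by rewrite /=; ring.
- move=> a ar; apply: site_eq => i; rewrite dE permM.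
  have {}ar : a != r :> nat by rewrite val_eqE.
  have := ltn_ord a => aq.
  have ar' : (a < r)%N by lia.
  case: tpermP => [->|->|/eqP/negbTE -> /eqP/negbTE ->]; last by rewrite !subrr.
    by rewrite eqxx eq_sym (negbTE Sr) vSr ar'.
  by rewrite eqxx (negbTE Sr) vSr ar'.
- apply: (site_neq _ _ ((s^-1)%g r)); rewrite dE permM permKV tpermL vSr ltnn ltn0.
  by rewrite eqxx (eq_sym r) (negbTE Sr) subr0 subrr oner_eq0.
Qed.

(** * Faces *)

Definition face s J : set 'rV[R]_q := [set y | forall a, a \in J -> voronoi_cell (site s a) y].

Lemma face_vtx s J : face s J (vtx s).
Proof. by move=> a _; exact: vtx_voronoi. Qed.

Lemma face_neighbor s J r t s' : A t -> r \notin J ->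
  (forall a, a != r -> site s a = site s' a + t) -> face s J (vtx s' + t).
Proof.
move=> tA rJ h a aJ; rewrite h; last by apply: contraNneq rJ => <-.
by rewrite voronoi_translate //; exact: vtx_voronoi.
Qed.

(** The functional is the sum of those that compare the distance to [w i0] with
    the distance to [w i]: it is extremal exactly where all of them are. *)
Lemma face_family (I : finType) (w : I -> 'rV[R]_q) (i0 : I) x :
  (forall i, A' (w i)) -> (forall i, voronoi_cell (w i) x) ->
  polytope_face (voronoi_cell (w i0)) [set y | forall i, voronoi_cell (w i) y].
Proof.
move=> wA wx; split; first by exists x.
exists (\sum_i (w i - w i0)), (\sum_i (sq (w i) - sq (w i0)) / 2).
have le y i : voronoi_cell (w i0) y ->
    dot (w i - w i0) y <= (sq (w i) - sq (w i0)) / 2.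
  move=> /voronoi_cellP[_ /(_ _ (wA i))]; rewrite !sqB !dotE ![dot y _]dotC; lra.
split=> [y hy|]; first by rewrite dot_suml; apply: ler_sum => i _; exact: le.
apply/seteqP; split=> y /=.
  move=> h; split; first exact: h.
  rewrite dot_suml; apply: eq_bigr => i _.
  have := voronoi_sq_eq (h i) (h i0) (wA i) (wA i0).
  by rewrite !sqB !dotE ![dot y _]dotC; lra.
move=> [y0 /eqP]; rewrite dot_suml -subr_eq0 -sumrB -oppr_eq0 -sumrN psumr_eq0 => [/allP h i|i _].
  have /eqP := h i (mem_index_enum _) => hi; apply: voronoi_cell_sq y0 _.
  by move: hi; rewrite !sqB !dotE ![dot y _]dotC; lra.
by have := le y i y0; lra.
Qed.

Lemma positive_bound (I : finType) (P : pred I) (f : I -> R) :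
  (forall i, P i -> 0 < f i) -> exists2 e, 0 < e & forall i, P i -> e <= f i.
Proof.
move=> h; exists (\big[Num.min/1]_(i | P i) f i).
  by apply/bigmin_gtP; split.
by move=> i Pi; apply: bigmin_le_cond.
Qed.

(** A segment that ends at a point with more tight sets can be prolonged a little
    beyond its other end. *)
Lemma cell_extend v w : cell v -> cell w -> (forall S, tight v S -> tight w S) ->
  exists2 e, 0 < e & cell (v - e *: (w - v)).
Proof.
move=> [vE vS] [wE wS] h.
have [S|e e0 he] := @positive_bound _ (fun S => ~~ tight v S)
    (fun S => (cell_bound R q #|S| - psum v S) / (1 + `|psum w S - psum v S|)).
  move=> nS; rewrite divr_gt0 //.
  by rewrite subr_gt0 lt_neqAle vS andbT.
exists e => //; split=> [|S].
  apply: hyperplaneD => //; apply: hyperplaneN; apply: hyperplaneZ.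
  by apply: hyperplaneD => //; apply: hyperplaneN.
have -> : psum (v - e *: (w - v)) S = psum v S - e * (psum w S - psum v S).
  by rewrite /psum !dotE.
case: (boolP (tight v S)) => tS.
  by have /eqP := h S tS; have /eqP := tS => -> ->; rewrite subrr mulr0 subr0.
have := he S tS; rewrite ler_pdivlMr; last by have := normr_ge0 (psum w S - psum v S); lra.
have : - (psum w S - psum v S) <= `|psum w S - psum v S| by rewrite -normrN ler_norm.
move: (`|_|) => n h1 h2; nra.
Qed.

Definition tights v : {set {set 'I_q}} := [set S | tight v S]%SET.

Lemma tights_mid v w : cell v -> cell w ->
  tights (2^-1 *: (v + w)) = tights v :&: tights w.
Proof.
move=> [_ vS] [_ wS]; apply/setP => S; rewrite !inE /tight.
have -> : psum (2^-1 *: (v + w)) S = (psum v S + psum w S) / 2.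
  by rewrite /psum !dotE mulrC.
have := vS S; have := wS S => h1 h2; apply/eqP/andP => [h|[/eqP h3 /eqP h4]]; last by lra.
by split; apply/eqP; lra.
Qed.

(** Take for [x] a point of the face with the fewest tight inequalities.  The
    midpoint of [x] and another point of the face has the tight inequalities
    common to both, hence those of [x].  Conversely, the segment from a point
    with these inequalities to [x] can be prolonged in the cell beyond [x], where
    the functional is maximal, so the functional is constant on it. *)
Lemma polytope_face_tights v G : A' v -> polytope_face (voronoi_cell v) G ->
  exists2 x, voronoi_cell v x & forall y,
    G y <-> voronoi_cell v y /\ tights (x - v) \subset tights (y - v).
Proof.
move=> vA [[g Gg] [a [c [hle hG]]]].
have GP y : G y -> voronoi_cell v y by rewrite hG => -[].
have Gc y : G y -> cell (y - v) by move=> /GP; rewrite voronoi_cell_shift.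
pose Q n := `[< exists2 x, G x & #|tights (x - v)| = n >].
have exQ : exists n, Q n by exists #|tights (g - v)|; apply/asboolP; exists g.
case: (ex_minnP exQ) => n /asboolP[x Gx xn] nmin.
exists x; first exact: GP.
move=> y; split=> [Gy|[yP xy]].
  split; first exact: GP.
  pose m := 2^-1 *: (x + y).
  have mE : m - v = 2^-1 *: ((x - v) + (y - v)).
    by apply/rowP => i; rewrite !mxE; field.
  have Gm : G m.
    move: (Gx) (Gy); rewrite hG => -[xP xc] [yP yc]; split.
      apply/(voronoi_cell_shift q0 _ vA); rewrite mE.
      split; last first.
        move=> S; have := (Gc _ Gx).2 S; have := (Gc _ Gy).2 S; rewrite /psum !dotE; lra.
      apply: hyperplaneZ; apply: hyperplaneD; [exact: (Gc _ Gx).1|exact: (Gc _ Gy).1].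
    by move: xc yc; rewrite /= /m !dotE => -> ->; field.
  have := nmin #|tights (m - v)|; rewrite -xn => /(_ (asboolT _)) h.
  have {h} : (#|tights (x - v)| <= #|tights (m - v)|)%N by apply: h; exists m.
  rewrite mE (tights_mid (Gc _ Gx) (Gc _ Gy)) => h.
  have := eqEcard (tights (x - v) :&: tights (y - v)) (tights (x - v)).
  rewrite finset.subsetIl h => /eqP e; rewrite -{1}e.
  exact: finset.subsetIr.
rewrite hG; split=> //.
have yc : cell (y - v) by apply/(voronoi_cell_shift q0).
have [S tS|e e0 he] := cell_extend (Gc _ Gx) yc.
  by have := fintype.subsetP xy S; rewrite !inE; apply.
have zP : voronoi_cell v (x - e *: (y - x)).
  apply/(voronoi_cell_shift q0) => //.
  suff -> : x - e *: (y - x) - v = x - v - e *: (y - v - (x - v)) by [].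
  by apply/rowP => i; rewrite !mxE; ring.
have := hle _ zP; have := hle _ yP; move: Gx; rewrite hG => -[_ /=].
rewrite !dotE => xc h1 h2; apply/eqP; rewrite eq_le h1 /=.
rewrite xc in h2; nra.
Qed.

(** A vertex of the cell at which all the inequalities tight at a generic point
    of [G] are tight has all the lattice points nearest to [G] among its own. *)
Lemma faceP v G : A' v -> polytope_face (voronoi_cell v) G ->
  exists s J t, [/\ J != finset.set0, A t & G = [set y | face s J (y - t)]].
Proof.
move=> vA /(polytope_face_tights vA)[x xP hG].
have xc : cell (x - v) by apply/(voronoi_cell_shift q0).
have [s0 hs0] := cell_vertex q0 xc.
have [s [t [tA hst]]] := vtx_translate s0 vA.
have tA' := root_dual q0 tA.
pose J := [set r | `[< voronoi_cell (site s r + t) x >]]%SET.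
(* The lattice points nearest to [x] are nearest to the vertex [vtx s + t]. *)
have near S : tight (x - v) S -> exists2 r, r \in J & centered (ind R S) + v = site s r + t.
  move=> tS; have := (voronoi_tight q0 S (vtx_cell R q0 s0)).2 (hs0 S tS).
  rewrite -(addrK v (vtx s0)) -voronoi_cell_translate // hst -(subrK t (_ + v)).
  rewrite voronoi_translate // => /voronoi_vtxP[|r e].
    by apply: dualB => //; apply: dualD => //; exact: ind_dual.
  exists r; last by rewrite -e subrK.
  rewrite inE; apply/asboolP; rewrite -e subrK voronoi_cell_translate //.
  exact/voronoi_tight.
exists s, J, t; split=> //.
  have [r rJ _] := near finset.set0 (tight_set0 _).
  by apply/finset.set0Pn; exists r.
apply/seteqP; split=> y /=.
  move=> /hG[yP xy] r; rewrite inE => /asboolP xr.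
  have yc : cell (y - v) by apply/(voronoi_cell_shift q0).
  rewrite -voronoi_cell_translate //.
  have rA : A' (site s r + t - v) by apply: dualB => //; apply: dualD => //; exact: site_dual.
  move: xr; rewrite -(subrK v (_ + t)) voronoi_cell_translate // => /(voronoi_tightP q0 xc rA)[S tS e].
  rewrite voronoi_cell_translate // e; apply/voronoi_tight => //.
  by have := fintype.subsetP xy S; rewrite !inE; apply.
move=> hy; have yP : voronoi_cell v y.
  have [r rJ] := near finset.set0 (tight_set0 _).
  rewrite ind0 (_ : centered 0 = 0) ?add0r => [->|].
    by rewrite voronoi_cell_translate //; exact: hy.
  by apply: centeredK; exact: hyperplane_0.
apply/hG; split=> //; have yc : cell (y - v) by apply/(voronoi_cell_shift q0).
apply/fintype.subsetP => S; rewrite !inE => tS; apply/voronoi_tight => //.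
have [r rJ e] := near S tS.
by rewrite -voronoi_cell_translate // e voronoi_cell_translate //; exact: hy.
Qed.

Lemma face_voronoi s J t : J != finset.set0 -> A t ->
  voronoi_faces R q [set y | face s J (y - t)].
Proof.
move=> /finset.set0Pn[r rJ] tA; have tA' := root_dual q0 tA.
pose w a := site s (if a \in J then a else r) + t.
exists (voronoi_cell (w r)).
  by exists (w r) => //; apply: dualD => //; exact: site_dual.
suff -> : [set y | face s J (y - t)] = [set y | forall a, voronoi_cell (w a) y].
  apply: (@face_family _ w r (vtx s + t)) => a; rewrite /w.
    by apply: dualD => //; exact: site_dual.
  by rewrite voronoi_translate //; exact: vtx_voronoi.
apply/seteqP; split=> y /= h a; have := h a; rewrite /w.
  by case: ifP => aJ; rewrite voronoi_cell_translate //; [apply|move=> _; exact: h].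
by move=> + aJ; rewrite aJ voronoi_cell_translate.
Qed.

Lemma linked_site J s u t : (forall a, a \in J -> site s a = site u a + t) ->
  forall i, linked J (s i) (u i).
Proof.
move=> h i a b /h ha /h hb; have := site_subE s u a i; have := site_subE s u b i.
rewrite ha hb ![_ + t]addrC !addrK => -> /eqP.
rewrite subr_eq addrAC eq_sym subr_eq -!natrD eqr_nat => /eqP; lia.
Qed.

Lemma site_linked J s u : J != finset.set0 -> (forall i, linked J (s i) (u i)) ->
  exists2 t, A t & forall a, a \in J -> site s a = site u a + t.
Proof.
move=> /finset.set0Pn[b bJ] h; exists (site s b - site u b).
  apply/(root_latticeP q0); split.
    by apply: hyperplaneD; [|apply: hyperplaneN]; apply: dual_hyperplane; exact: site_dual.
  by move=> i; rewrite site_subE rpredB // natr_int.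
move=> a aJ; suff <- : site s a - site u a = site s b - site u b by rewrite addrC subrK.
apply/rowP => i; rewrite !site_subE; apply/eqP.
rewrite subr_eq addrAC eq_sym subr_eq -!natrD eqr_nat; apply/eqP.
by have := h i a b aJ bJ; lia.
Qed.

Lemma face_linked J s u : J != finset.set0 -> (forall i, linked J (s i) (u i)) ->
  exists2 t, A t & face s J = [set y | face u J (y - t)].
Proof.
move=> J0 /(site_linked J0)[t tA h]; exists t => //; have tA' := root_dual q0 tA.
apply/seteqP; split=> y hy a aJ.
  by have := hy a aJ; rewrite h // voronoi_cell_translate.
by rewrite h // voronoi_cell_translate //; exact: hy.
Qed.

(** The vertex [vtx s] belongs to both faces, and its nearest lattice points are
    pairwise inequivalent, so the sites of the second face are sites of [s] with
    the same indices.  If one of their indices [a] were not in [J], the neighbour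
    of [vtx s] across the site [a] would be in the first face only. *)
Lemma face_subset (q1 : (1 < q)%N) J J' s u t : A t ->
  (face s J `<=` [set y | face u J' (y - t)]) ->
  J' \subset J /\ forall i, linked J' (s i) (u i).
Proof.
move=> tA sub; have tA' := root_dual q0 tA.
have eq_site a : a \in J' -> site s a = site u a + t.
  move=> aJ; have := sub _ (@face_vtx s J) a aJ; rewrite -voronoi_cell_translate //.
  case/voronoi_vtxP => [|b e]; first by apply: dualD => //; exact: site_dual.
  suff ab : a = b by rewrite e ab.
  by apply: (@site_class u s); rewrite -e opprD addrA subrr sub0r; exact: root_latticeN.
split; last exact: linked_site eq_site.
apply/fintype.subsetP => a aJ'; apply/negPn/negP => aJ.
have [t' [t'A _ h /negP[]]] := @vtx_neighbor s a q1.
have := sub _ (face_neighbor t'A aJ h) a aJ'.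
rewrite -voronoi_cell_translate // -eq_site // -(subrK t' (site s a)) voronoi_translate //.
case/voronoi_vtxP => [|b e]; first by apply: dualB; [exact: site_dual|exact: root_dual].
suff ab : a = b by rewrite e -ab.
by apply/(@site_class s (s * tperm a (ordS a))%g); rewrite -e opprB addrC subrK.
Qed.

End Faces.

(** * Dimension of the faces *)

Lemma affine_dim_eq (R : realType) (n : nat) (F : set 'rV[R]_n) (m : nat) : (m <= n)%N ->
  (exists (x : 'rV[R]_n) (M : 'M[R]_(m, n)),
    [/\ F x, forall i, F (x + row i M) & row_free M]) ->
  (forall k (x : 'rV[R]_n) (M : 'M[R]_(k, n)),
    F x -> (forall i, F (x + row i M)) -> row_free M -> (k <= m)%N) ->
  affine_dim F = m.
Proof.
move=> mn ex up; apply/eqP; rewrite eqn_leq; apply/andP; split.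
  by apply/bigmax_leqP => k /asboolP[x [M [Fx FM fM]]]; exact: up Fx FM fM.
have mn' : (m < n.+1)%N by [].
by apply: (@leq_bigmax_cond _ _ _ (Ordinal mn')); apply/asboolP.
Qed.

Section Dimension.
Variables (R : realType) (q : nat).
Hypothesis q1 : (1 < q)%N.
Implicit Types (s : 'S_q) (J : {set 'I_q}) (t : 'rV[R]_q).
Let q0 : (0 < q)%N := ltnW q1.
Let qR := @qR0 R q q0.

(** Up to the factor [1 / q], the step from [vtx s] to its neighbour obtained by
    exchanging the values [r] and [r + 1 mod q]. *)
Definition edge_vec s (r : 'I_q) : 'rV[R]_q :=
  edge_dir R ((s^-1)%g r) ((s^-1)%g (ordS r)).

Lemma edge_vec_sum s (c : 'I_q -> R) y :
  (\sum_r c r *: edge_vec s r) 0 ((s^-1)%g (ordS y)) = c (ordS y) - c y.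
Proof.
rewrite summxE (eq_bigr (fun r => c r * (ordS y == r)%:R - c r * (y == r)%:R)).
  rewrite sumrB (bigD1 (ordS y)) //= eqxx big1 => [|r /negbTE ry]; last first.
    by rewrite eq_sym ry mulr0.
  rewrite (bigD1 y) //= eqxx big1 => [|r /negbTE ry]; first by rewrite !mulr1 !addr0.
  by rewrite eq_sym ry mulr0.
move=> r _; rewrite mxE edge_dirE !(inj_eq perm_inj) (inj_eq (@ordS_inj q)); ring.
Qed.

(** Summation by parts along the cycle: [dot (site s r) dd] is the sum of the
    coordinates of [dd] at the positions with value above [r]. *)
Lemma edge_vec_decomposition s (dd : 'rV[R]_q) (C : R) : hyperplane0 R q dd ->
  dd = \sum_r (C - dot (site R s r) dd) *: edge_vec s r.
Proof.
move=> ddE; apply/rowP => i; rewrite -(permK s i) -[s i](ord_predK).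
move: (ord_pred _) => y; rewrite edge_vec_sum.
rewrite opprB addrC addrA subrK !dot_centeredl // /dot -sumrB.
rewrite (eq_bigr (fun j => (s j == ordS y)%:R * dd 0 j -
    ((y.+1 == q)%:R * dd 0 j))) => [|j _]; last first.
  rewrite !mxE !inE -mulrBl -[RHS]mulrBl; congr (_ * _).
  have := val_ordS y; have := ltn_ord y; have := ltn_ord (s j).
  rewrite -(inj_eq val_inj) /= -/(ordS y).
  case: (ltnP y.+1 q) => h h1 h2 ->.
    have -> : (y.+1 == q) = false by apply/eqP; lia.
    have -> : (y < s j)%N = (s j == y.+1 :> nat) || (y.+1 < s j)%N by lia.
    by case: eqP => [->|_]; rewrite ?ltnn /= ?subr0 // subrr.
  have -> : (y.+1 == q) by apply/eqP; lia.
  have -> : (y < s j)%N = false by lia.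
  by case: (nat_of_ord (s j)) => [|k] /=; rewrite ?subrr ?subr0.
rewrite sumrB -mulr_sumr [X in _ - _ * X]ddE mulr0 subr0.
rewrite (bigD1 ((s^-1)%g (ordS y))) //= permKV eqxx mul1r big1 ?addr0 // => j.
by rewrite -(inj_eq (@perm_inj _ s)) permKV => /negbTE ->; rewrite mul0r.
Qed.

Definition edge_mx s J : 'M[R]_(#|~: J|, q) :=
  \matrix_(k, i) edge_vec s (enum_val k) 0 i.

Lemma row_edge_mx s J k : row k (edge_mx s J) = edge_vec s (enum_val k).
Proof. by apply/rowP => i; rewrite !mxE. Qed.

(** A linear relation between the edge vectors has the same coefficient all around
    the cycle, and [0] at the indices in [J]. *)
Lemma edge_mx_free s J : J != finset.set0 -> row_free (edge_mx s J).
Proof.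
move=> /finset.set0Pn[r0 r0J]; apply: inj_row_free => v v0.
pose c r := \sum_(k | enum_val k == r) v 0 k.
have cJ r : r \in J -> c r = 0.
  move=> rJ; apply: big_pred0 => k; apply/negP => /eqP e.
  by have := enum_valP k; rewrite e inE rJ.
have c0 y : c (ordS y) = c y.
  apply/subr0_eq; rewrite -(edge_vec_sum s).
  suff -> : \sum_r c r *: edge_vec s r = v *m edge_mx s J by rewrite v0 mxE.
  rewrite mulmx_sum_row; under eq_bigr do rewrite scaler_suml.
  rewrite (exchange_big_dep predT) //=; apply: eq_bigr => k _.
  by rewrite (big_pred1 (enum_val k)) ?row_edge_mx // => r; rewrite eq_sym.
have {}c0 r : c r = 0 by apply: (@ordS_ind _ (fun r => c r = 0) r0); rewrite ?cJ // => x; rewrite c0.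
apply/rowP => k; rewrite mxE -(c0 (enum_val k)) /c (big_pred1 k) // => k'.
by rewrite (inj_eq enum_val_inj).
Qed.

(** The vector joining two points of the face has the same inner product with
    all the sites of the face, so by summation by parts it is a combination of
    the edge vectors outside [J]. *)
Lemma affine_dim_face s J t : J != finset.set0 -> root_lattice R q t ->
  affine_dim [set y | face s J (y - t)] = (q - #|J|)%N.
Proof.
move=> J0 tA; have cJ : (#|~: J|%SET = q - #|J|)%N.
  by rewrite -[X in (X - _)%N](card_ord q) -(cardsC J) addKn.
rewrite -cJ; apply: affine_dim_eq.
- by rewrite cJ leq_subr.
- exists (vtx R s + t), (q%:R^-1 *: edge_mx s J); split.
  + by rewrite /= addrK; exact: face_vtx.
  + move=> k; rewrite /= addrAC addrK linearZ /= row_edge_mx.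
    have [t' [t'A e h _]] := vtx_neighbor R q0 s (enum_val k) q1.
    move: e; rewrite div1r -/(edge_vec _ _) => ->.
    apply: face_neighbor t'A _ h => //; have := enum_valP k.
    by rewrite inE.
  + by rewrite /row_free mxrank_scale_nz ?invr_neq0 //; exact: edge_mx_free.
- move=> k x M Fx FM /eqP rM; rewrite -rM.
  apply: leq_trans (mxrankS _) (rank_leq_row (edge_mx s J)).
  apply/row_subP => i; have /= Fi := FM i; rewrite /= in Fx.
  have [r0 r0J] := finset.set0Pn _ J0.
  set dd := row i M in Fi *.
  have ddE : hyperplane0 R q dd.
    have -> : dd = (x + dd - t) - (x - t) by apply/rowP => j; rewrite !mxE; ring.
    apply: hyperplaneD; [|apply: hyperplaneN].
      by have [] := Fi r0 r0J.
    by have [] := Fx r0 r0J.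
  have const a : a \in J -> dot (site R s a) dd = dot (site R s r0) dd.
    move=> aJ; have e1 := voronoi_sq_eq (Fx a aJ) (Fx r0 r0J) (site_dual R q0 s a) (site_dual R q0 s r0).
    have e2 := voronoi_sq_eq (Fi a aJ) (Fi r0 r0J) (site_dual R q0 s a) (site_dual R q0 s r0).
    move: e1 e2; rewrite !(sqB _ (site R s _)) !dotE ![dot dd _]dotC; lra.
  rewrite (edge_vec_decomposition s (dot (site R s r0) dd) ddE).
  apply: summx_sub => r _; have [rJ|rJ] := boolP (r \in J).
    by rewrite const // subrr scale0r sub0mx.
  have rJ' : r \in ~: J by rewrite inE.
  rewrite -[r in edge_vec s r](enum_rankK_in rJ' rJ') -row_edge_mx.
  by apply: scalemx_sub; exact: row_sub.
Qed.

End Dimension.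

(** * The tessellation of the torus *)

Section Torus.
Variables (R : realType) (q : nat).
Hypothesis q0 : (0 < q)%N.
Implicit Types (v w x y z t : 'rV[R]_q) (F G : set 'rV[R]_q).

Local Notation E := (hyperplane0 R q).
Local Notation A := (root_lattice R q).
Local Notation A' := (dual_root_lattice R q).
Local Notation proj := (@torus_proj R q).
Local Notation supp := (@Defs.support R q).
Let qR := @qR0 R q q0.
Let qRp := @qR_gt0 R q q0.

Lemma imageD F t : [set x + t | x in F] = [set y | F (y - t)].
Proof.
apply/seteqP; split=> y /=; first by case=> x Fx <-; rewrite addrK.
by move=> h; exists (y - t); rewrite ?subrK.
Qed.

Lemma torus_projP x y : proj x = proj y <-> A (x - y).
Proof.
split=> [e|h].
  have : proj x x by exists 0; [exact: root_lattice0|rewrite addr0].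
  by rewrite e => -[t tA <-]; rewrite addrC addKr.
apply/seteqP; split=> z [t tA <-].
  exists (t + (x - y)); first exact: root_latticeD.
  by apply/rowP => i; rewrite !mxE; ring.
exists (t - (x - y)); first exact: root_latticeB.
by apply/rowP => i; rewrite !mxE; ring.
Qed.

Lemma torusP x : torus R q (proj x) <-> E x.
Proof.
split=> [[y yE /torus_projP]|xE]; last by exists x.
move=> /(root_hyperplane q0) h; rewrite -(subKr y x).
by apply: hyperplaneD => //; apply: hyperplaneN.
Qed.

Lemma support_translation_class F x :
  supp (translation_class F) (proj x) <-> exists2 t, A t & F (x - t).
Proof.
split=> [[_ [t tA <-] [_ [y Fy <-] /esym/torus_projP h]]|[t tA h]].
  exists (t + (x - (y + t))); first exact: root_latticeD.
  by rewrite (_ : x - _ = y) //; apply/rowP => i; rewrite !mxE; ring.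
exists [set y + t | y in F]; first by exists t.
by exists x => //; rewrite imageD.
Qed.

Lemma supportP C X : supp C X -> exists x, X = proj x.
Proof. by case=> F _ [x _ <-]; exists x. Qed.

Lemma translation_class_refl F : translation_class F F.
Proof.
exists 0; first exact: root_lattice0.
by rewrite imageD; apply/seteqP; split=> y; rewrite /= subr0.
Qed.

Lemma translation_class_eq F t : A t ->
  translation_class [set y | F (y - t)] = translation_class F.
Proof.
move=> tA; apply/seteqP; split=> _ [u uA <-].
  exists (t + u); first exact: root_latticeD.
  by rewrite !imageD; apply/seteqP; split=> y /=; rewrite opprD addrA addrAC.
exists (u - t); first exact: root_latticeB.
rewrite !imageD; apply/seteqP; split=> y /=.
  by rewrite opprB addrA addrAC addrK.
by rewrite opprB addrA addrAC addrK.
Qed.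

Lemma voronoi_cell_class v w : A (w - v) ->
  translation_class (voronoi_cell w) = translation_class (voronoi_cell v).
Proof.
move=> h; rewrite -(translation_class_eq (voronoi_cell v) h); congr translation_class.
have h' := root_dual q0 h.
by apply/seteqP; split=> y /=; rewrite -voronoi_cell_translate // addrC subrK.
Qed.

Lemma support_cellP v x : A' v ->
  supp (translation_class (voronoi_cell v)) (proj x) <->
  exists w, [/\ A' w, A (w - v) & voronoi_cell w x].
Proof.
move=> vA; rewrite support_translation_class; split=> [[t tA h]|[w [wA wv h]]].
  have tA' := root_dual q0 tA.
  exists (v + t); split; [exact: dualD|by rewrite addrC addKr|].
  by rewrite voronoi_cell_translate.
exists (w - v) => //; rewrite -voronoi_cell_translate; last exact: dualB.
by rewrite addrC subrK.
Qed.

Lemma quotient_tilesP C : quotient_tiles R q C <->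
  exists2 v, A' v & C = translation_class (voronoi_cell v).
Proof.
split=> [[_ [v vA <-] <-]|[v vA ->]]; first by exists v.
by exists (voronoi_cell v) => //; exists v.
Qed.

(** A point moved towards the center of one of its cells leaves all the
    others. *)
Lemma voronoi_star v w x (e : R) : A' v -> A' w -> 0 < e <= 1 ->
  voronoi_cell v x -> voronoi_cell w (x + e *: (v - x)) -> w = v.
Proof.
move=> vA wA /andP[e0 e1] /voronoi_cellP[_ /(_ w wA) h1] /voronoi_cellP[_ /(_ v vA) h2].
apply/subr0_eq/sq_eq0; apply/le_anti; rewrite sq_ge0 andbT.
have e3 : sq (x + e *: (v - x) - w) - sq (x + e *: (v - x) - v) =
    (1 - e) * (sq (x - w) - sq (x - v)) + e * sq (w - v).
  rewrite /sq !dotE (dotC v x) (dotC w x) (dotC w v); ring.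
have : e * sq (w - v) <= e * 0.
  rewrite mulr0; have : 0 <= (1 - e) * (sq (x - w) - sq (x - v)).
    by apply: mulr_ge0; rewrite subr_ge0.
  lra.
by rewrite ler_pM2l.
Qed.

Lemma torus_open_segment (U : set (set 'rV[R]_q)) x y : torus_open U ->
  E x -> E y -> U (proj x) ->
  exists2 e : R, 0 < e <= 1 & U (proj (x + e *: (y - x))).
Proof.
move=> [_ oU] xE yE Ux.
have : within E (nbhs x) (proj @^-1` U).
  by rewrite nbhs_subspace_in //; exact: (@open_nbhs_nbhs (subspace E)).
rewrite /within /= => /nbhs_ballP[d /= d0 dU].
have [i _|e e0 he] := @positive_bound R _ predT
    (fun i => d / (1 + `|(y - x) 0 i|)).
  by rewrite divr_gt0 //; have := normr_ge0 ((y - x) 0 i); lra.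
pose e' := Num.min 1 (e / 2).
have e'0 : 0 < e' by rewrite lt_min ltr01 divr_gt0.
have e'1 : e' <= 1 by rewrite ge_min lexx.
have e'e : e' < e by rewrite gt_min; apply/orP; right; lra.
exists e'; first by rewrite e'0 e'1.
apply: (dU (x + e' *: (y - x))).
  split=> // i j; rewrite ord1 /ball /= mxE [X in _ - (_ + X)]mxE.
  rewrite opprD addrA subrr sub0r normrN normrM (gtr0_norm e'0).
  have := he j isT; rewrite ler_pdivlMr; last by have := normr_ge0 ((y - x) 0 j); lra.
  have : 0 <= `|(y - x) 0 j| by exact: normr_ge0.
  move: (`|_|) => n n0 h; nra.
apply: hyperplaneD => //; apply: hyperplaneZ; apply: hyperplaneD => //.
exact: hyperplaneN.
Qed.

Lemma tiles_tessellate : tessellates_torus (quotient_tiles R q).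
Proof.
split.
  apply/seteqP; split=> X.
    move=> [C /quotient_tilesP[v vA ->] /[dup] /supportP[x ->]].
    by move=> /(support_cellP _ vA)[w [_ _ [xE _]]]; apply/torusP.
  move=> [x xE <-]; have [v vA vx] := exists_nearest q0 xE.
  exists (translation_class (voronoi_cell v)); first by apply/quotient_tilesP; exists v.
  apply/(support_cellP _ vA); exists v; split=> //; rewrite subrr; exact: root_lattice0.
move=> C D /quotient_tilesP[v vA ->] /quotient_tilesP[w wA ->] CD.
apply/seteqP; split=> // X [[U [oU UC] UX] [V [oV VD] VX]].
apply: CD; have [x Xx] := supportP (UC _ UX); subst X.
have /(support_cellP _ vA)[v' [v'A vv' xv']] := UC _ UX.
have xE : E x by case: xv'.
have [e e01 /VD/(support_cellP _ wA)[w' [w'A ww' yw']]] :=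
  torus_open_segment oV xE (dual_hyperplane v'A) VX.
have e' := voronoi_star v'A w'A e01 xv' yw'; subst w'.
apply: voronoi_cell_class; rewrite (_ : v - w = (v' - w) - (v' - v)).
  exact: root_latticeB.
by apply/rowP => i; rewrite !mxE; ring.
Qed.

(** Over a point that two tiles of the torus share, a cell of the one class meets
    a cell of the other, and the intersection of two cells is a face of both. *)
Lemma tiles_face_to_face : face_to_face (quotient_tiles R q) (quotient_faces R q).
Proof.
move=> C D /quotient_tilesP[v vA ->] /quotient_tilesP[w wA ->].
exists [set X | exists v' w' x, [/\ A' v', A' w', A (v' - v), A (w' - w) &
  [/\ voronoi_cell v' x, voronoi_cell w' x &
      X = translation_class (voronoi_cell v' `&` voronoi_cell w')]]].
split.
  move=> X [v' [w' [x [v'A w'A vv' ww' [xv' xw' ->]]]]]; split.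
  - exists (voronoi_cell v' `&` voronoi_cell w') => //.
    exists (voronoi_cell v'); first by exists v'.
    have -> : voronoi_cell v' `&` voronoi_cell w' =
        [set y | forall b : bool, voronoi_cell (if b then v' else w') y].
      apply/seteqP; split=> y /=; first by move=> [h1 h2] [].
      by move=> h; split; [exact: (h true)|exact: (h false)].
    by apply: (@face_family R q _ (fun b : bool => if b then v' else w') true x) => -[].
  - exists (voronoi_cell v' `&` voronoi_cell w'), (voronoi_cell v'); split=> //.
    + exact: translation_class_refl.
    + rewrite -(voronoi_cell_class vv'); exact: translation_class_refl.
  - exists (voronoi_cell v' `&` voronoi_cell w'), (voronoi_cell w'); split=> //.
    + exact: translation_class_refl.
    + rewrite -(voronoi_cell_class ww'); exact: translation_class_refl.
apply/seteqP; split=> X.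
  move=> [/[dup] /supportP[x ->] /(support_cellP _ vA)[v' [v'A vv' xv']]].
  move=> /(support_cellP _ wA)[w' [w'A ww' xw']].
  exists (translation_class (voronoi_cell v' `&` voronoi_cell w')).
    by exists v', w', x.
  apply/support_translation_class; exists 0; first exact: root_lattice0.
  by rewrite subr0.
move=> [_ [v' [w' [_ [v'A w'A vv' ww' [_ _ ->]]]]] /[dup] /supportP[x ->]].
move=> /support_translation_class[t tA [xv' xw']].
by split; [rewrite -(voronoi_cell_class vv')|rewrite -(voronoi_cell_class ww')];
  apply/support_translation_class; exists t.
Qed.

Lemma edistE x y : Defs.edist x y = Num.sqrt (sq (x - y)).
Proof. by []. Qed.

Lemma hull_image (I : finType) (p : I -> 'rV[R]_q) (c : R) b :
  (fun x => c *: x + b) @` convex_hull p = convex_hull (fun i => c *: p i + b).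
Proof.
have e (w : I -> R) : \sum_i w i = 1 ->
    c *: (\sum_i w i *: p i) + b = \sum_i w i *: (c *: p i + b).
  move=> w1; rewrite scaler_sumr -[in LHS](scale1r b) -w1 scaler_suml -big_split /=.
  by apply: eq_bigr => i _; rewrite scalerDr !scalerA mulrC.
apply/seteqP; split=> x.
  by move=> [_ [w [w0 w1 ->]] <-]; exists w; rewrite e.
move=> [w [w0 w1 ->]]; exists (\sum_i w i *: p i); last exact: e.
by exists w.
Qed.

Lemma tiles_permutahedral P : voronoi_tiles R q P -> permutahedral P.
Proof.
move=> [v vA <-]; split; last first.
  move=> x y /set_mem/(voronoi_cell_shift q0 _ vA) xc /set_mem/(voronoi_cell_shift q0 _ vA) yc.
  move=> /torus_projP/(root_latticeP q0)[_ h]; apply/rowP => i.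
  apply/subr0_eq; rewrite -rowBE; apply: int_small; first exact: h.
  have := cell_lower q0 i xc; have := cell_upper q0 i xc.
  have := cell_lower q0 i yc; have := cell_upper q0 i yc.
  have : 0 < 1 / (2 * q%:R) :> R by rewrite divr_gt0 // mulr_gt0.
  rewrite !rowBE ltr_norml; lra.
pose b := v - const_mx ((1 / 2) / q%:R + 1 / 2).
exists q%:R^-1, (fun x => q%:R^-1 *: x + b); split.
- by rewrite invr_gt0.
- move=> x y; rewrite !edistE.
  have -> : q%:R^-1 *: x + b - (q%:R^-1 *: y + b) = q%:R^-1 *: (x - y).
    by apply/rowP => i; rewrite !mxE; ring.
  rewrite /sq dotZl dotZr mulrA -expr2 sqrtrM ?sqr_ge0 // sqrtr_sqr ger0_norm //.
- rewrite hull_image.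
  have -> : (fun s : 'S_q => q%:R^-1 *: \row_i (s i).+1%:R + b) = (fun s => 1 *: vtx R s + v).
    apply/funext => s; apply/rowP => i; rewrite !mxE -[(s i).+1%:R]natr1; field; exact: qR.
  rewrite -hull_image; apply/seteqP; split=> x.
    move=> /(voronoi_cell_shift q0 _ vA) /(cell_hull q0) h.
    by exists (x - v) => //; rewrite scale1r subrK.
  move=> [y /(hull_cell q0) yc <-]; apply/(voronoi_cell_shift q0 _ vA).
  by rewrite scale1r addrK.
Qed.

Lemma card_quotient_tiles : (quotient_tiles R q #= [set: 'I_q])%card.
Proof.
pose f (r : 'I_q) := translation_class (voronoi_cell (site R 1%g r)).
have -> : quotient_tiles R q = f @` [set: 'I_q].
  apply/seteqP; split=> C.
    move=> /quotient_tilesP[v vA ->]; have [r rA] := root_class q0 1%g vA.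
    by exists r => //; rewrite /f (voronoi_cell_class rA).
  move=> [r _ <-]; apply/quotient_tilesP; exists (site R 1%g r) => //; exact: site_dual.
apply: inj_card_eq => r r' _ _ e.
have : f r' (voronoi_cell (site R 1%g r)) by rewrite -e; exact: translation_class_refl.
move=> [t tA]; rewrite imageD => e'.
have tA' := root_dual q0 tA; have lA r := site_dual R q0 1%g r.
have : voronoi_cell (site R 1%g r) (site R 1%g r).
  by apply/(voronoi_cell_shift q0) => //; rewrite subrr; apply/(voronoi0P q0)/voronoi_cellP;
    split=> [|w wA]; [exact: hyperplane_0|rewrite subr0 {1}/sq dot0l sq_ge0].
rewrite -e' /= -voronoi_cell_translate // => h.
have {}h := voronoi_center h (lA r).
by apply: (@site_class R q q0 1%g 1%g); rewrite h addrC addKr.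
Qed.

End Torus.

(** * The two face posets *)

Lemma bijection_of_codes (D X Y : Type) (f : D -> X) (g : D -> Y) :
  (forall x, exists a, f a = x) -> (forall y, exists a, g a = y) ->
  (forall a b, f a = f b <-> g a = g b) ->
  exists2 h : X -> Y, bijective h & forall a, h (f a) = g a.
Proof.
move=> fS gS fg; pose f' x := projT1 (cid (fS x)); pose g' y := projT1 (cid (gS y)).
have f'K x : f (f' x) = x by rewrite /f'; case: cid.
have g'K y : g (g' y) = y by rewrite /g'; case: cid.
exists (g \o f') => [|a]; last by apply/fg; rewrite f'K.
exists (f \o g') => x /=; first by rewrite -[RHS]f'K; apply/fg; rewrite g'K.
by rewrite -[RHS]g'K; apply/fg; rewrite f'K.
Qed.

Section Codes.
Variable q : nat.
Hypothesis q3 : (3 <= q)%N.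
Implicit Types (J : {set 'I_q}) (s u : 'S_q).
Let q1 : (1 < q)%N := ltnW q3.
Let q0 : (0 < q)%N := ltnW q1.

(** [Some (J, s)] stands for [face s J], and for the greatest face if [J] is
    empty; [None] stands for the least face.  A face has several codes. *)
Definition code := option ({set 'I_q} * 'S_q).
Implicit Types (a b : code).

Definition code_le a b : Prop :=
  match a, b with
  | None, _ => True
  | Some _, None => False
  | Some x, Some y => y.1 \subset x.1 /\ forall i, linked y.1 (x.2 i) (y.2 i)
  end.

Definition code_rank a : int :=
  if a is Some x then (q - #|x.1|)%N%:Z else -1.

Lemma code_le_refl a : code_le a a.
Proof. by case: a => // x; split=> // i; exact: linked_refl. Qed.

Section GraphicahedronCodes.

Local Notation pairs := [set x : {set {set 'I_q}} * 'S_q | x.1 \subset edges (@cycle_graph q)]%SET.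

Definition pair_class (x : {set {set 'I_q}} * 'S_q) :=
  [set y in pairs | pair_equiv x y]%SET.

Definition code_pair J s : {set {set 'I_q}} * 'S_q := (edges_off J, (s^-1)%g).

Lemma code_pair_mem J s : code_pair J s \in pairs.
Proof. by rewrite inE /= edges_cycle sub_edges_off // finset.sub0set. Qed.

Lemma pair_class_face J s :
  pair_class (code_pair J s) \in graphicahedron_faces (@cycle_graph q).
Proof. by apply/imsetP; exists (code_pair J s); first exact: code_pair_mem. Qed.

Lemma mem_pair_class x : x \in pairs -> x \in pair_class x.
Proof. by move=> h; rewrite inE h /pair_equiv !eqxx. Qed.

Definition graph_of a : graphicahedron (@cycle_graph q) :=
  if a is Some x then
    Some (exist (fun X => X \in graphicahedron_faces (@cycle_graph q)) _ (pair_class_face x.1 x.2))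
  else None.

Lemma graph_of_surj X : exists a, graph_of a = X.
Proof.
case: X => [[X hX]|]; last by exists None.
have /imsetP[[K s]] := hX; rewrite inE /= => /edges_offP[J ->] e.
by exists (Some (J, (s^-1)%g)); congr Some; apply/val_inj; rewrite /= e /code_pair invgK.
Qed.

Lemma sub_rcoset (K K' : {set {set 'I_q}}) s u : K \subset K' ->
  ((edge_group K :* s)%g \subset (edge_group K' :* u)%g) = (s * u^-1 \in edge_group K')%g.
Proof.
move=> KK'; pose G := [group of edge_group K']; have gG : edge_group K' = G by [].
have sub : edge_group K \subset edge_group K'.
  apply: genS; apply/fintype.subsetP => t /imsetP[ij]; rewrite inE => h ->.
  by apply/imsetP; exists ij; rewrite ?inE //; exact: (fintype.subsetP KK').
rewrite -mem_rcoset; apply/idP/idP => [/fintype.subsetP|h].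
  by apply; exact: (rcoset_refl [group of edge_group K]).
rewrite gG in h *; rewrite -(rcoset_eqP h); exact: mulSg.
Qed.

Lemma coset_subset J J' s u : J' \subset J ->
  pair_coset (code_pair J s) \subset pair_coset (code_pair J' u) <->
  forall i, linked J' (s i) (u i).
Proof.
move=> JJ'; rewrite /pair_coset /= sub_rcoset ?sub_edges_off //.
rewrite invgK edge_groupP //; split=> h i; last by have := h ((s^-1)%g i); rewrite permKV permM.
by have := h (s i); rewrite permM permK.
Qed.

Lemma graph_of_le a b : graphicahedron_le (graph_of a) (graph_of b) <-> code_le a b.
Proof.
case: a => [[J s]|] //; case: b => [[J' u]|] //=.
split=> [[x [y []]]|[JJ' h]].
  rewrite inE => /andP[_ /andP[/eqP ex /eqP cx]].
  rewrite inE => /andP[_ /andP[/eqP ey /eqP cy]].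
  rewrite -ex -ey -cx -cy /= sub_edges_off // => JJ' h; split=> //.
  exact/(coset_subset s u JJ').
exists (code_pair J s), (code_pair J' u); split.
- exact/mem_pair_class/code_pair_mem.
- exact/mem_pair_class/code_pair_mem.
- by rewrite sub_edges_off.
- exact/(coset_subset s u JJ').
Qed.

Lemma graph_of_eq a b : graph_of a = graph_of b <-> code_le a b /\ code_le b a.
Proof.
split=> [e|].
  by split; apply/graph_of_le; rewrite e; apply/graph_of_le; exact: code_le_refl.
case: a => [[J s]|]; case: b => [[J' u]|] //; try by case.
move=> [[/= JJ' h1] [/= J'J h2]].
have JE : J' = J by apply/eqP; rewrite finset.eqEsubset JJ' J'J.
subst J'; congr Some; apply/val_inj => /=; apply/setP => x; rewrite !inE; congr (_ && _).
rewrite /pair_equiv (_ : pair_coset (code_pair J s) = pair_coset (code_pair J u)) //.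
by apply/eqP; rewrite finset.eqEsubset; apply/andP; split; apply/coset_subset.
Qed.

Lemma graph_of_rank a k : graphicahedron_rank (graph_of a) k <-> k = code_rank a.
Proof.
case: a => [[J s]|] //=; split=> [[x]|->].
  by rewrite inE => /andP[_ /andP[/eqP <- _]] ->; rewrite card_edges_off.
exists (code_pair J s); first exact/mem_pair_class/code_pair_mem.
by rewrite card_edges_off.
Qed.

End GraphicahedronCodes.

Section QuotientCodes.
Variable R : realType.

Lemma face_quotient s J : J != finset.set0 ->
  translation_class (face s J) \in quotient_faces R q.
Proof.
move=> J0; apply/mem_set; exists (face s J) => //.
have := face_voronoi q0 s J0 (root_lattice0 R q0).
by congr (voronoi_faces _ _ _); apply/seteqP; split=> y /=; rewrite subr0.
Qed.

Definition quotient_of a : quotient_poset R q :=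
  match a with
  | None => Least R q
  | Some x => if x.1 == finset.set0 then Greatest R q
      else oapp (@Face R q) (Greatest R q) (insub (translation_class (face x.2 x.1)))
  end.

Lemma quotient_of0 s : quotient_of (Some (finset.set0, s)) = Greatest R q.
Proof. by rewrite /quotient_of eqxx. Qed.

Lemma quotient_of_face J s : J != finset.set0 ->
  exists2 C, quotient_of (Some (J, s)) = Face C & val C = translation_class (face s J).
Proof.
move=> J0; rewrite /quotient_of (negbTE J0) insubT; first exact: face_quotient.
by move=> h; eexists; first by []; rewrite SubK.
Qed.

Lemma quotient_of_surj X : exists a, quotient_of a = X.
Proof.
case: X => [|C|]; first by exists None.
  2: by exists (Some (finset.set0, 1%g)); exact: quotient_of0.
have [G [_ [v vA <-] hG] GC] := set_mem (valP C).
have [s [J [t [J0 tA Ge]]]] := faceP q0 vA hG.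
exists (Some (J, s)); have [D -> De] := quotient_of_face s J0.
by congr Face; apply/val_inj; rewrite De -GC Ge translation_class_eq.
Qed.

Lemma incidentP (F G : set 'rV[R]_q) :
  incident (translation_class F) (translation_class G) <->
  exists2 t, root_lattice R q t & F `<=` [set y | G (y - t)].
Proof.
split=> [[_ [_ [[t tA <-] [u uA <-]]]]|[t tA h]].
  rewrite !imageD => h; exists (u - t); first exact: root_latticeB.
  by move=> y Fy; have /= := h (y + t); rewrite addrK => /(_ Fy); rewrite opprB addrA.
exists F, [set x + t | x in G]; split; first exact: translation_class_refl.
  by exists t.
by rewrite imageD.
Qed.

Lemma quotient_of_le a b : quotient_le (quotient_of a) (quotient_of b) <-> code_le a b.
Proof.
case: a => [[J s]|]; last by [].
case: b => [[J' u]|]; last first.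
  have [->|J0] := eqVneq J finset.set0; first by rewrite quotient_of0.
  by have [C -> _] := quotient_of_face s J0.
have [->|J'0] := eqVneq J' finset.set0.
  rewrite quotient_of0; split=> [_|_]; last by case: quotient_of.
  by split=> [|i a b]; rewrite ?finset.sub0set ?inE.
have [D -> De] := quotient_of_face u J'0.
have [->|J0] := eqVneq J finset.set0.
  rewrite quotient_of0 /= finset.subset0; split=> // -[/eqP e]; by rewrite e eqxx in J'0.
have [C -> Ce] := quotient_of_face s J0.
rewrite /= Ce De incidentP; split=> [[t tA]|[JJ' h]].
  exact: (face_subset q0 q1).
have [t tA e] := face_linked R q0 J'0 h; exists t => //.
by rewrite -e => y hy x /(fintype.subsetP JJ'); exact: hy.
Qed.

Lemma quotient_of_eq a b : quotient_of a = quotient_of b <-> code_le a b /\ code_le b a.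
Proof.
split=> [e|].
  by split; apply/quotient_of_le; rewrite e; apply/quotient_of_le; exact: code_le_refl.
case: a => [[J s]|]; case: b => [[J' u]|] //; try by case.
move=> [[JJ' h] [J'J _]].
have JE : J' = J by apply/eqP; rewrite finset.eqEsubset JJ' J'J.
subst J'; have [->|J0] := eqVneq J finset.set0; first by rewrite !quotient_of0.
have [C -> Ce] := quotient_of_face s J0; have [D -> De] := quotient_of_face u J0.
congr Face; apply/val_inj; rewrite Ce De.
by have [t tA ->] := face_linked R q0 J0 h; rewrite translation_class_eq.
Qed.

Lemma quotient_of_rank a k : quotient_rank (quotient_of a) k <-> k = code_rank a.
Proof.
case: a => [[J s]|] //; have [->|J0] := eqVneq J finset.set0.
  by rewrite quotient_of0 /= cards0 subn0.
have [C -> Ce] := quotient_of_face s J0; rewrite /= Ce; split=> [[_ [t tA <-]] ->|->].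
  by rewrite imageD (affine_dim_face q1).
exists [set y + 0 | y in face s J]; first by exists 0 => //; exact: root_lattice0.
by rewrite imageD (affine_dim_face q1) //; exact: root_lattice0.
Qed.

End QuotientCodes.

End Codes.

Theorem theorem8 (R : realType) (q : nat) (hq : (3 <= q)%N) :
  [/\ tessellates_torus (quotient_tiles R q),
      face_to_face (quotient_tiles R q) (quotient_faces R q),
      forall P, voronoi_tiles R q P -> permutahedral P,
      (quotient_tiles R q #= [set: 'I_q])%card
    & exists f : quotient_poset R q -> graphicahedron (@cycle_graph q),
        [/\ bijective f,
            forall x y, quotient_le x y <-> graphicahedron_le (f x) (f y)
          & forall x k, quotient_rank x k <-> graphicahedron_rank (f x) k]].
Proof.
have q0 : (0 < q)%N by apply: leq_trans hq.
split.
- exact: tiles_tessellate.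
- exact: tiles_face_to_face.
- exact: tiles_permutahedral.
- exact: card_quotient_tiles.
have [f f_bij fE] := bijection_of_codes (quotient_of_surj hq (R := R)) (graph_of_surj hq)
  (fun a b => iff_trans (quotient_of_eq hq R a b) (iff_sym (graph_of_eq hq a b))).
exists f; split=> // [x y|x k].
  have [a <-] := quotient_of_surj hq x; have [b <-] := quotient_of_surj hq y.
  rewrite !fE.
  exact: iff_trans (quotient_of_le hq R a b) (iff_sym (graph_of_le hq a b)).
have [a <-] := quotient_of_surj hq x.
rewrite fE.
exact: iff_trans (quotient_of_rank hq R a k) (iff_sym (graph_of_rank hq a k)).
Qed.
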